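(* Suppose that (a) for every $x\in\mathbb X$, $\delta(t)f(X^x_t)\to0$ as $t\to\infty$, $\mathbb P^x$-a.s.; (b) $X$ is regular, i.e. for every $x\in\mathrm{int}(\mathbb X)$, $\mathbb P^x(T^x_y<\infty)>0$ for all $y\in\mathbb X$; and (c) $\delta(s)\delta(t)<\delta(s+t)$ for all $s,t>0$. Let $T^*\in\mathcal E$ be a closed optimal equilibrium, and suppose that $R^*:=\bigcap_{R\in\mathcal E,\ R\text{ closed}}R$ is an optimal equilibrium. For $x\in\mathbb X\setminus R^*$ let $\ell_*(x):=\sup\{y\in R^*: y<x\}$ (taken to be $\inf\mathbb X$ if there is no such $y$) and $r_*(x):=\inf\{y\in R^*: y>x\}$ (taken to be $\sup\mathbb X$ if there is no such $y$). Then for any $x\in\mathbb X\setminus R^*$: (i) if $(\ell_*(x),r_*(x))\cap C_{R^*}\ne\emptyset$, then $T^*\cap(\ell_*(x),r_*(x))=\emptyset$; (ii) if $(\ell_*(x),r_*(x))\cap C_{R^*}=\emptyset$ and $f\not\equiv0$ on $(\ell_*(x),r_*(x))$, then either $T^*\cap(\ell_*(x),r_*(x))=\emptyset$ or $(\ell_*(x),r_*(x))\subseteq T^*$; (iii) if $(\ell_*(x),r_*(x))\cap C_{R^*}=\emptyset$ and $f\equiv0$ on $(\ell_*(x),r_*(x))$, then for any Borel subset $A$ of $(\ell_*(x),r_*(x))$, $R^*\cup A$ is an optimal equilibrium.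
   Context: $X=(X_t)_{t\ge 0}$ is a time-homogeneous continuous strong Markov process on a probability space $(\Omega,\mathcal F,\mathbb P)$, taking values in an interval $\mathbb X\subseteq\mathbb R$. $\mathcal B(\mathbb X)$ is the collection of Borel subsets of $\mathbb X$; $\mathbb P^x,\mathbb E^x$ denote probability and expectation given $X_0=x$, and $X^x$ denotes $X$ started at $x\in\mathbb X$. For distinct $x,y\in\mathbb X$, $T^x_y:=\inf\{t\ge0: X^x_t=y\}$. The payoff function $f:\mathbb X\to[0,\infty)$ is continuous. The discount function $\delta:[0,\infty)\to(0,1]$ is non-increasing and continuous, with $\delta(0)=1$ and $\delta(t)\to0$ as $t\to\infty$. For $x\in\mathbb X$, $R\in\mathcal B(\mathbb X)$: $\rho(x,R):=\inf\{t>0: X^x_t\in R\}$ ($\inf\emptyset=\infty$) and $J(x,R):=\mathbb E^x[\delta(\rho(x,R))f(X_{\rho(x,R)})]$, where on $\{\rho(x,R)=\infty\}$ the integrand is taken to be $\limsup_{t\to\infty}\delta(t)f(X^x_t)$. Put $S_R:=\{x: f(x)>J(x,R)\}$, $I_R:=\{x: f(x)=J(x,R)\}$, $C_R:=\{x: f(x)<J(x,R)\}$, and $\Theta(R):=S_R\cup(I_R\cap R)$. $R\in\mathcal B(\mathbb X)$ is an equilibrium if $\Theta(R)=R$; $\mathcal E$ is the set of all equilibria. $V(x,R):=\max\{f(x),J(x,R)\}$. $\hat R\in\mathcal E$ is an optimal equilibrium if $V(x,\hat R)\ge V(x,R)$ for all $x\in\mathbb X$ and all $R\in\mathcal E$.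 ''Closed'' means closed relative to $\mathbb X$. *)

(* Defs.v *)
From HB Require Import structures.
From mathcomp Require Import all_boot all_order all_algebra.
From mathcomp Require Import all_classical all_reals all_analysis.
From mathcomp Require Import measurable_realfun.
Set Implicit Arguments.
Unset Strict Implicit.
Unset Printing Implicit Defensive.
Import Order.TTheory GRing.Theory Num.Theory.
Import numFieldNormedType.Exports.
Local Open Scope classical_set_scope.
Local Open Scope ring_scope.

(** A process with state space an interval [XX] of the real line is a family of
    real random variables [X t], of which only the times [0 <= t] matter; its
    laws are a family of probabilities [P x], of which only the starting points
    [x] in [XX] matter. *)

(** The cylinder sigma-algebra on path space. Its members only constrain a path
    on [[0, +oo[]. *)
Definition path_event (R : realType) : set_system (R -> R) :=
  <<s [set C | exists t (B : set R),
         [/\ 0 <= t, measurable B & C = [set w : R -> R | B (w t)]] ]>>.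

Section process.
Context (d : measure_display) (R : realType) (Omega : measurableType d).
Variables (XX : set R) (P : R -> probability Omega R) (X : R -> Omega -> R).

Definition natural_filtration (t : R) : set_system Omega :=
  <<s [set C | exists s (B : set R),
         [/\ 0 <= s, s <= t, measurable B & C = X s @^-1` B] ]>>.

(** Optional times: stopping times of the right-continuous filtration
    [F_(t+)]. *)
Definition optional_time (tau : Omega -> \bar R) :=
  (forall w, (0 <= tau w)%E) /\
  (forall t : R, 0 < t ->
     natural_filtration t [set w | (tau w < t%:E)%E]).

(** The sigma-algebra [F_(tau+)] of an optional time. *)
Definition optional_events (tau : Omega -> \bar R) : set_system Omega :=
  [set L | measurable L /\
     forall t : R, 0 < t ->
       natural_filtration t (L `&` [set w | (tau w < t%:E)%E])].

(** Strong Markov property with respect to [F_(t+)], in terms of the path after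
    [tau]: on [tau < +oo], the conditional law of [X (tau + .)] given [F_(tau+)]
    is the law of [X] under [P (X tau)]. Using the raw natural filtration and
    optional times is no restriction compared with the augmented filtration,
    whose stopping times are almost surely equal to optional times. *)
Definition strong_markov :=
  forall x (tau : Omega -> \bar R) (L : set Omega) (B : set (R -> R)),
    XX x -> optional_time tau -> optional_events tau L -> path_event B ->
    P x (L `&` [set w | (tau w < +oo)%E] `&`
         [set w | B (fun t => X (fine (tau w) + t) w)]) =
    (\int[P x]_(w in L `&` [set w | (tau w < +oo)%E])
       P (X (fine (tau w)) w) [set w' | B (fun t => X t w')])%E.

Record continuous_strong_markov_process : Prop := ContinuousStrongMarkov {
  csm_measurable : forall t, 0 <= t -> measurable_fun setT (X t) ;
  csm_state : forall t w, 0 <= t -> XX (X t w) ;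
  csm_continuous : forall w, {within `[0, +oo[, continuous (fun t => X t w)} ;
  csm_start : forall x, XX x -> P x [set w | X 0 w = x] = 1%E ;
  csm_kernel : forall B : set (R -> R), path_event B ->
    measurable_fun XX (fun x => P x [set w | B (fun t => X t w)]) ;
  csm_strong_markov : strong_markov
}.

(** [T_y]: the first time [t >= 0] at which the process is at [y]. *)
Definition point_hitting_time (y : R) (w : Omega) : \bar R :=
  ereal_inf (EFin @` [set t | 0 <= t /\ X t w = y]).

Definition regular :=
  forall x y, XX° x -> XX y ->
    (0 < P x [set w | (point_hitting_time y w < +oo)%E])%E.

(** Evaluated under [P x], this is [rho(x, A)]; time [0] is excluded. *)
Definition rho (A : set R) (w : Omega) : \bar R :=
  ereal_inf (EFin @` [set t | 0 < t /\ A (X t w)]).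

Variables (f delta : R -> R).

(** [rho] is never [-oo], so the last case is the event [rho = +oo]. *)
Definition payoff (A : set R) (w : Omega) : \bar R :=
  if rho A w is t%:E then (delta t * f (X t w))%:E
  else limf_esup (fun t => (delta t * f (X t w))%:E) (pinfty_nbhs R).

(** The hitting time of a Borel set is in general only measurable for the
    completion of [P x]. The integral of the library is, for a nonnegative
    integrand, a supremum over measurable simple functions below it, and hence
    agrees here with the integral with respect to the completion. *)
Definition J (x : R) (A : set R) : \bar R := (\int[P x]_w payoff A w)%E.

Definition S_ (A : set R) := [set x | XX x /\ (J x A < (f x)%:E)%E].
Definition I_ (A : set R) := [set x | XX x /\ (f x)%:E = J x A].
Definition C_ (A : set R) := [set x | XX x /\ ((f x)%:E < J x A)%E].

Definition Theta (A : set R) := S_ A `|` (I_ A `&` A).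

Definition equilibrium (A : set R) :=
  [/\ measurable A, A `<=` XX & Theta A = A].

Definition V (x : R) (A : set R) : \bar R := maxe (f x)%:E (J x A).

Definition optimal_equilibrium (A : set R) :=
  equilibrium A /\
  forall x (B : set R), XX x -> equilibrium B -> (V x B <= V x A)%E.

Definition closed_in (A : set R) := exists2 F, closed F & A = XX `&` F.

Definition Rstar : set R :=
  \bigcap_(A in [set A | equilibrium A /\ closed_in A]) A.

End process.

Section gaps.
Context (R : realType).
Variables (XX A : set R) (x : R).

Definition gap_left : \bar R :=
  if pselect (exists2 y, A y & y < x)
  then ereal_sup (EFin @` [set y | A y /\ y < x])
  else ereal_inf (EFin @` XX).

Definition gap_right : \bar R :=
  if pselect (exists2 y, A y & x < y)
  then ereal_inf (EFin @` [set y | A y /\ x < y])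
  else ereal_sup (EFin @` XX).

Definition gap : set R :=
  [set z | (gap_left < z%:E)%E /\ (z%:E < gap_right)%E].

End gaps.

Record discount_function (R : realType) (delta : R -> R) : Prop := Discount {
  discount_range : forall t, 0 <= t -> 0 < delta t <= 1 ;
  discount_nonincreasing : forall s t, 0 <= s -> s <= t -> delta t <= delta s ;
  discount_continuous : {within `[0, +oo[, continuous delta} ;
  discount0 : delta 0 = 1 ;
  discount_cvg0 : delta t @[t --> +oo] --> 0
}.

(* Main.v *)
(** Write [S] for [Rstar] and [T] for [Tstar], so that [S] is contained in [T]
    and [V(., S) = V(., T)], and let [I] be a gap of [S].

    Key point: if [T] meets [I] without containing it, then [f] and [J(., S)]
    vanish on [I]. Take [x0] in [I] outside [T], and let [c] be the point of [T]
    in [I] closest to [x0] on one side. Since [x0] lies in neither equilibrium,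
    [J(x0, S)] and [J(x0, T)] are both equal to the value [V(x0)]; similarly
    [f = J(., S)] on [T] minus [S]. If [f c > 0], compare the two payoffs from
    [x0]: they agree when the process enters [T] inside [S]; otherwise the strong
    Markov property at the entrance time [tau] and
    [delta tau * delta t < delta (tau + t)] give [J(x0, S) > J(x0, T)], because
    [c] is reached first with positive probability. Hence [f c = 0 = J(c, S)], so
    from [c] the payoff at the entrance into [S] vanishes almost surely, and since
    every point of [I] can be reached from [c] before [S], [J(., S)] vanishes on
    [I], and so does [f <= J(., S)].

    If [f] and [J(., S)] vanish on [I], visiting a subset [A] of [I] before [S]
    almost surely does not change the payoff, so that [J(., S `|` A) = J(., S)]. *)

Require Import Defs.
From HB Require Import structures.
From mathcomp Require Import all_boot all_order all_algebra.
From mathcomp Require Import all_classical all_reals all_analysis.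
From mathcomp Require Import measurable_realfun.
From mathcomp Require Import lra.
Import Order.TTheory GRing.Theory Num.Theory.
Import numFieldNormedType.Exports.
Local Open Scope classical_set_scope.
Local Open Scope ring_scope.
Set Implicit Arguments.
Unset Strict Implicit.
Unset Printing Implicit Defensive.

(** * Hitting times of continuous paths *)

Section paths.
Context {R : realType}.
Implicit Types (w : R -> R) (F : set R) (a b c q s t : R).

Definition cont0 w := {within `[0, +oo[, continuous w}.

(** Freezing a path at [w 0] for negative times trades continuity on a subspace for plain continuity
    on the line. It works because [Num.max 0] is 1-Lipschitz and is the identity on nonnegative
    times. *)
Lemma cont0_max w : cont0 w <-> continuous (fun t => w (Num.max 0 t)).
Proof.
split => [/subspace_continuousP cw t|cw].
  have t0 : `[0, +oo[%classic (Num.max 0 t) by rewrite /= in_itv/= le_max lexx.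
  have /cvgrPdist_lt/= H := cw _ t0.
  apply/cvgrPdist_lt => /= e e0.
  have {H} := H _ e0; rewrite /within/= => /nbhs_ballP[r /= r0 H].
  apply/nbhs_ballP; exists r => //= s /= ts.
  apply: H; last by rewrite /= in_itv/= le_max lexx.
  rewrite /ball/=; apply: le_lt_trans ts.
  have := ler_norm (t - s); have := ler_norm (s - t); rewrite distrC => h1 h2.
  by rewrite ler_norml /Num.max; case: ltP => ?; case: ltP => ?; apply/andP; split; lra.
apply: (@subspace_eq_continuous _ _ _ (fun t => w (Num.max 0 t))).
  by move=> t; rewrite inE/= in_itv/= andbT => t0; rewrite max_r.
exact: continuous_subspaceT.
Qed.

Lemma cont0_itv w a b : cont0 w -> 0 <= a -> {within `[a, b], continuous w}.
Proof.
move=> cw a0; apply: continuous_subspaceW cw => t /=.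
by rewrite !in_itv/= andbT => /andP[+ _]; exact: le_trans.
Qed.

Lemma cont0_shift w s : cont0 w -> 0 <= s -> cont0 (fun t => w (s + t)).
Proof.
move=> /cont0_max cw s0; apply/cont0_max.
have -> : (fun t => w (s + Num.max 0 t)) =
    (fun t => w (Num.max 0 t)) \o (fun t => s + Num.max 0 t).
  apply/funext => t /=; congr w; apply/esym/max_r.
  by rewrite addr_ge0// le_max lexx.
move=> t; apply: continuous_comp; last exact: cw.
apply: cvgD; first exact: cvg_cst.
apply: continuous_max; [exact: cvg_cst|exact: cvg_id].
Qed.

Lemma cont0_ivt w a b c : cont0 w -> 0 <= a -> a <= b ->
  (w a <= c <= w b) || (w b <= c <= w a) -> exists2 t, a <= t <= b & w t = c.
Proof.
move=> cw a0 ab abc; have [|t] := @IVT _ w a b c ab (cont0_itv cw a0).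
  by rewrite ge_min le_max; case/orP : abc => /andP[-> ->]; rewrite ?orbT.
by rewrite in_itv/= => ?; exists t.
Qed.

(** Unlike in [rho], time [0] counts, so that on a closed set the infimum is attained whenever it is
    finite. *)
Definition hit F w : \bar R := ereal_inf (EFin @` [set t | 0 <= t /\ F (w t)]).

Lemma hit_ge0 F w : (0 <= hit F w)%E.
Proof. by apply: le_ereal_inf_tmp => _ [t [t0 _] <-]; rewrite lee_fin. Qed.

Lemma hit_le F w t : 0 <= t -> F (w t) -> (hit F w <= t%:E)%E.
Proof. by move=> t0 Ft; apply: ereal_inf_lbound; exists t. Qed.

Lemma before_hit F w t : 0 <= t -> (t%:E < hit F w)%E -> ~ F (w t).
Proof. by move=> t0 + Ft; rewrite ltNge hit_le. Qed.

Lemma hit_lt F w (s : \bar R) : (hit F w < s)%E ->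
  exists t, [/\ 0 <= t, F (w t) & (t%:E < s)%E].
Proof. by move=> /ereal_inf_lt[_ [t [t0 Ft] <-] ts]; exists t. Qed.

Lemma hit_fin F w : (hit F w < +oo)%E -> (fine (hit F w))%:E = hit F w.
Proof. by move=> ?; rewrite fineK// ge0_fin_numE// hit_ge0. Qed.

(** If [w t] were outside [F], the path would stay in the open complement for a while around [t],
    and no visit could occur soon after [t]. *)
Lemma hit_attained F w t : cont0 w -> closed F -> hit F w = t%:E ->
  0 <= t /\ F (w t).
Proof.
move=> cw cF ht; have t0 : 0 <= t by rewrite -lee_fin -ht hit_ge0.
split=> //; apply: contrapT => nFt.
have : \forall s \near t, ~ F (w (Num.max 0 s)).
  move/cont0_max : cw => /(_ t) /= cw.
  apply: (cw (~` F)); rewrite max_r//.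
  by apply: open_nbhs_nbhs; split => //; exact: closed_openC.
move=> /nbhs_ballP[e /= e0 He].
have : (hit F w < (t + e)%:E)%E by rewrite ht lte_fin ltrDl.
move=> /hit_lt[s [s0 Fs]]; rewrite lte_fin => ste.
have ts : t <= s by rewrite -lee_fin -ht; exact: hit_le.
apply: (He s); last by rewrite max_r.
by rewrite /ball/= ler0_norm ?subr_le0//; lra.
Qed.

Lemma hit_ltP (F : set R) (w : R -> R) (t : R) :
  (hit F w < t%:E)%E <->
  exists r : rat, [/\ 0 <= (ratr r : R), ratr r < t & (hit F w <= (ratr r)%:E)%E].
Proof.
split=> [ht|[r [_ rt hr]]]; last by apply: le_lt_trans hr _; rewrite lte_fin.
have hoo : (hit F w < +oo)%E by rewrite (lt_trans ht)// ltry.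
have := hit_ge0 F w; move: ht; rewrite -(hit_fin hoo) lte_fin lee_fin => ht h0.
have [r] := @rat_in_itvoo R _ _ ht.
rewrite in_itv/= => /andP[r1 r2]; exists r.
by rewrite lee_fin (le_trans h0 (ltW r1)) r2 (ltW r1).
Qed.

Lemma hit_le_ex F w q : cont0 w -> closed F -> (hit F w <= q%:E)%E ->
  exists t, [/\ 0 <= t, t <= q & F (w t)].
Proof.
move=> cw cF hq; have h : (hit F w < +oo)%E by rewrite (le_lt_trans hq)// ltry.
have /(hit_attained cw cF)[t0 Ft] := esym (hit_fin h).
by exists (fine (hit F w)); split => //; rewrite -lee_fin hit_fin.
Qed.

(** Open neighbourhoods shrinking to a closed [F]. A path seldom meets [F] at a rational time, but
    it meets these at rational times. *)
Definition thicken F n : set R := [set y | exists2 z, F z & `|y - z| < n.+1%:R^-1].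

Lemma open_thicken (F : set R) n : open (thicken F n).
Proof.
rewrite openE => y [z Fz yz]; apply/nbhs_ballP.
exists (n.+1%:R^-1 - `|y - z|); first by rewrite /= subr_gt0.
move=> u /= yu; exists z => //; apply: le_lt_trans (ler_distD y _ _) _.
by move: yu; rewrite /ball/= (distrC u) => yu; rewrite -ltrBrDr; exact: yu.
Qed.

(** This reduces hitting to countably many coordinates. Just before a visit to [F] there are
    rational times at which the path is close to [F]; conversely, a path avoiding [F] on the compact
    [[0, q]] keeps a positive distance from it. *)
Lemma hit_leP F w q : cont0 w -> closed F ->
  (hit F w <= q%:E)%E <->
  (forall n, exists2 r : rat, 0 <= (ratr r : R) <= q & thicken F n (w (ratr r))).
Proof.
move=> cw cF; have cm := (cont0_max w).1 cw; split.
  move=> /(hit_le_ex cw cF)[t [t0 tq Ft]] n.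
  (* The rational time is sought strictly below [t], which is impossible at [t = 0]; there [0]
     itself serves. *)
  have [t00|tn0] := eqVneq t 0.
    move: Ft tq; rewrite t00 => Ft tq; exists 0; rewrite rmorph0 ?lexx//.
    by exists (w 0) => //; rewrite subrr normr0 invr_gt0.
  have /cvgrPdist_lt/(_ n.+1%:R^-1) := cm t.
  rewrite invr_gt0 ltr0n => /(_ isT)/nbhs_ballP[e /= e0 He].
  have [|r] := @rat_in_itvoo R (Num.max 0 (t - e)) t.
    by rewrite gt_max ltrBlDr ltrDl e0 andbT lt_def t0 andbT.
  rewrite in_itv/= gt_max => /andP[/andP[r0 re] rt].
  exists r; first by rewrite (ltW r0)/= (le_trans (ltW rt)).
  exists (w t) => //; have := He (ratr r).
  rewrite (max_r t0) (max_r (ltW r0)) distrC; apply.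
  by rewrite /ball/= gtr0_norm; lra.
move=> Hn; apply: contrapT => /negP; rewrite -ltNge => qh.
(* Compactness makes one [n] work for all times in [[0, q]]. *)
have near_avoid : \forall n \near \oo,
    `[0, q]%classic `<=` (fun t => ~ thicken F n (w (Num.max 0 t))).
  apply: (compact_near_coveringP _).1 (@segment_compact R 0 q) _ _ _ _ _ => t.
  rewrite /= in_itv/= => /andP[t0 tq].
  have : (~` F) (w (Num.max 0 t)).
    rewrite /= max_r//; apply: (@before_hit F w t) => //.
    by apply: le_lt_trans qh; rewrite lee_fin.
  move=> Ft; have : nbhs (w (Num.max 0 t)) (~` F).
    by apply: open_nbhs_nbhs; split => //; exact: closed_openC.
  move=> /nbhs_ballP[e /= e0 He].
  have /cvgrPdist_lt/(_ (e / 2)) := cm t.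
  rewrite divr_gt0// => /(_ isT) Hw.
  exists ([set s | `|w (Num.max 0 t) - w (Num.max 0 s)| < e / 2],
          [set n | n.+1%:R^-1 < e / 2]).
    split => //=; apply: (near_infty_natSinv_lt (PosNum (divr_gt0 e0 _))).
    by [].
  move=> [s n] /= [ws ne] [z Fz wz]; apply: (He z) => //.
  rewrite /ball/= (splitr e).
  apply: le_lt_trans (ler_distD (w (Num.max 0 s)) _ _) _.
  by rewrite ltrD// (lt_trans wz).
have [n _ Hn0] := near_avoid.
have [r /andP[r0 rq]] := Hn n.
have := Hn0 n (leqnn n) (ratr r).
by rewrite /= in_itv/= r0 rq max_r//; apply.
Qed.

Lemma hit_shift F w s : 0 <= s -> (forall t, 0 <= t -> t < s -> ~ F (w t)) ->
  hit F w = (s%:E + hit F (fun t => w (s + t)%R))%E.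
Proof.
move=> s0 nF; apply/eqP; rewrite eq_le; apply/andP; split.
  rewrite addeC -leeBlDr//; apply: le_ereal_inf_tmp => _ [t [t0 Ft] <-].
  by rewrite leeBlDr// -EFinD addrC hit_le// addr_ge0.
apply: le_ereal_inf_tmp => _ [t [t0 Ft] <-].
have st : s <= t by rewrite leNgt; apply/negP => /nF; exact.
rewrite addeC -leeBrDr// -EFinB hit_le ?subr_ge0//.
by rewrite addrC subrK.
Qed.

End paths.

(** * Measurability of hitting times and of paths sampled at random times *)

Section measurable_paths.
Context {R : realType} d (S : measurableType d) (Y : S -> R -> R).
Hypothesis Yc : forall s, cont0 (Y s).
Arguments Yc : clear implicits.

(** Only the coordinates up to time [q] are assumed measurable, so that the sigma-algebra may be
    that of the past. *)
Lemma measurable_hit_le (F : set R) (q : R) : closed F ->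
  (forall t, 0 <= t <= q -> measurable_fun setT (Y^~ t)) ->
  measurable [set s | (hit F (Y s) <= q%:E)%E].
Proof.
move=> cF mY.
have -> : [set s | (hit F (Y s) <= q%:E)%E] = \bigcap_n \bigcup_r
   [set s | 0 <= (ratr r : R) <= q /\ thicken F n (Y s (ratr r))].
  apply/seteqP; split => [s /= /(hit_leP _ (Yc s) cF) H n _|s /= H].
    by have [r ? ?] := H n; exists r.
  apply/(hit_leP _ (Yc s) cF) => n; have [r _ [? ?]] := H n I.
  by exists r.
apply: bigcapT_measurable => n; apply: bigcupT_measurable_rat => r.
have [rq|/negP rq] := boolP (0 <= (ratr r : R) <= q); last first.
  by rewrite (_ : [set _ | _] = set0)//; apply/seteqP; split => // s [].
rewrite (_ : [set _ | _] = (Y^~ (ratr r)) @^-1` thicken F n); last first.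
  by apply/seteqP; split => s /=; [case|].
rewrite -[X in measurable X]setTI; apply: (mY _ rq) => //.
by apply: open_measurable; exact: open_thicken.
Qed.

Lemma measurable_hit_lt (F : set R) (q : R) : closed F ->
  (forall t, 0 <= t -> t < q -> measurable_fun setT (Y^~ t)) ->
  measurable [set s | (hit F (Y s) < q%:E)%E].
Proof.
move=> cF mY.
rewrite (_ : [set _ | _] = \bigcup_(r : rat) (if 0 <= (ratr r : R) < q then
   [set s | (hit F (Y s) <= (ratr r)%:E)%E] else set0)); last first.
  apply/seteqP; split => [s /= /hit_ltP [r [r0 rq hr]]|s [r _]].
    by exists r => //; rewrite r0 rq.
  case: ifPn => // /andP[r0 rq] /= hr.
  by apply: le_lt_trans hr _; rewrite lte_fin.
apply: bigcupT_measurable_rat => r; case: ifPn => // /andP[r0 rq].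
apply: measurable_hit_le => // t /andP[t0 tr]; apply: mY => //.
exact: le_lt_trans tr rq.
Qed.

Hypothesis mY : forall t, 0 <= t -> measurable_fun setT (Y^~ t).

Lemma measurable_hit (F : set R) : closed F ->
  measurable_fun setT (fun s => hit F (Y s)).
Proof.
move=> cF; apply: (measurability _ (ErealGenInftyO.measurableE R)).
move=> _ -[_ [x ->]] <-; rewrite setTI.
rewrite (_ : _ @^-1` _ = [set s | (hit F (Y s) < x%:E)%E]); last first.
  by apply/seteqP; split => s /=; rewrite in_itv.
by apply: measurable_hit_lt => // t t0 _; exact: mY.
Qed.

(** The random time is rounded down to the grid of mesh [1 / (n + 1)], where sampling is a countable
    case distinction; continuity of the paths gives the limit. *)
Lemma measurable_sample (sg : S -> R) : (forall s, 0 <= sg s) ->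
  measurable_fun setT sg -> measurable_fun setT (fun s => Y s (sg s)).
Proof.
move=> sg0 msg.
pose k n s := Num.truncn (sg s * n.+1%:R).
have kP n s : (k n s)%:R <= sg s * n.+1%:R < (k n s).+1%:R.
  by apply: truncn_itv; rewrite mulr_ge0.
apply: (@measurable_fun_cvg _ _ _ _ (fun n s => Y s ((k n s)%:R / n.+1%:R))).
  move=> n _ B mB; rewrite setTI.
  have -> : (fun s => Y s ((k n s)%:R / n.+1%:R)) @^-1` B = \bigcup_j
      ([set s | j%:R <= sg s * n.+1%:R] `&` [set s | sg s * n.+1%:R < j.+1%:R] `&`
       (Y^~ (j%:R / n.+1%:R)) @^-1` B).
    apply/seteqP; split => [s /= Bs|s [j _ /= [[s1 s2]]]].
      by exists (k n s) => //=; have /andP[] := kP n s.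
    by rewrite /k (@truncn_def _ _ j)// s1 s2.
  have msn : measurable_fun setT (fun s => sg s * n.+1%:R) by exact: measurable_funM.
  apply: bigcupT_measurable => j; apply: measurableI; first apply: measurableI.
  - rewrite (_ : [set _ | _] = (fun s => sg s * n.+1%:R) @^-1` `[j%:R, +oo[).
      by rewrite -[X in measurable X]setTI; exact: msn.
    by apply/seteqP; split => s /=; rewrite in_itv/= andbT.
  - rewrite (_ : [set _ | _] = (fun s => sg s * n.+1%:R) @^-1` `]-oo, j.+1%:R[).
      by rewrite -[X in measurable X]setTI; exact: msn.
    by apply/seteqP; split => s /=; rewrite in_itv.
  - rewrite -[X in measurable X]setTI; exact: mY.
move=> s _.
have kcvg : (k n s)%:R / n.+1%:R @[n --> \oo] --> sg s.
  apply/cvgrPdist_lt => e e0; near=> n.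
  have n0 : 0 < n.+1%:R :> R by rewrite ltr0n.
  have /andP[k1 k2] := kP n s.
  have -> : sg s - (k n s)%:R / n.+1%:R = (sg s * n.+1%:R - (k n s)%:R) / n.+1%:R.
    by rewrite mulrBl mulfK ?gt_eqF.
  rewrite ger0_norm ?divr_ge0 ?subr_ge0// ?ltW//.
  apply: (@le_lt_trans _ _ n.+1%:R^-1); last first.
    by near: n; exact: (near_infty_natSinv_lt (PosNum e0)).
  by rewrite -[leRHS]mul1r ler_pM2r ?invr_gt0// lerBlDl natr1 ltW.
have := (cont0_max _).1 (@Yc s) (sg s).
rewrite /continuous_at max_r// => cY.
have := cvg_comp _ _ kcvg cY.
apply: cvg_trans; apply: near_eq_cvg; near=> n => /=.
by rewrite max_r// divr_ge0.
Unshelve. all: by end_near. Qed.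

End measurable_paths.

(* The cylinder sigma-algebra is traced on the continuous paths: on all of
   [R -> R], hitting times are not measurable. *)
Record cpath (R : realType) := CPath { cfun :> R -> R ; cfun_cont : cont0 cfun }.

Section cpath_pointed.
Variable R : realType.

HB.instance Definition _ := gen_eqMixin (cpath R).
HB.instance Definition _ := gen_choiceMixin (cpath R).

Lemma cont0_cst (c : R) : cont0 (fun=> c).
Proof. by apply/cont0_max => t; exact: cvg_cst. Qed.

HB.instance Definition _ := isPointed.Build (cpath R) (CPath (@cont0_cst 0)).

Definition cpath_event : set (set (cpath R)) :=
  preimage_set_system setT (@cfun R) (@path_event R).

Lemma sigma_algebra_cpath_event : sigma_algebra setT cpath_event.
Proof. by apply: sigma_algebra_preimage; exact: smallest_sigma_algebra. Qed.

Lemma cpath_event0 : cpath_event set0.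
Proof. by have [] := sigma_algebra_cpath_event. Qed.

Lemma cpath_eventC (A : set (cpath R)) : cpath_event A -> cpath_event (~` A).
Proof. by have [_ H _] := sigma_algebra_cpath_event; rewrite -setTD; exact: H. Qed.

Lemma cpath_event_bigcup (F : (set (cpath R))^nat) :
  (forall i, cpath_event (F i)) -> cpath_event (\bigcup_i F i).
Proof. by have [_ _ H] := sigma_algebra_cpath_event; exact: H. Qed.

Definition cpath_display : measure_display.
Proof. exact. Qed.

HB.instance Definition _ := @isMeasurable.Build cpath_display (cpath R)
  cpath_event cpath_event0 cpath_eventC cpath_event_bigcup.

Lemma cpath_eventP (C : set (cpath R)) : measurable C ->
  exists2 B, path_event B & forall w : cpath R, C w <-> B w.
Proof. by move=> [B eB <-]; exists B => // w; rewrite setTI. Qed.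

(** The sets of paths with measurable preimage form a sigma-algebra, which contains the generating
    cylinders. *)
Lemma measurable_cpath d (S : measurableType d) (h : S -> cpath R) :
  (forall t, 0 <= t -> measurable_fun setT (fun s => h s t)) ->
  measurable_fun setT h.
Proof.
move=> mh _ _ [B eB <-]; rewrite !setTI.
pose G := [set B : set (R -> R) | measurable (h @^-1` (@cfun R @^-1` B))].
suff : @path_event R `<=` G by apply.
apply: smallest_sub.
  split; rewrite /G/=.
  - by rewrite !preimage_set0.
  - by move=> A mA; rewrite setTD; exact: (measurableC mA).
  - by move=> A mA; rewrite !preimage_bigcup; apply: bigcup_measurable => k _; exact: mA.
move=> _ [t [D [t0 mD ->]]].
by rewrite /G/= -[X in measurable X]setTI; exact: mh.
Qed.

Lemma measurable_eval (t : R) : 0 <= t -> measurable_fun setT (fun w : cpath R => w t).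
Proof.
move=> t0 _ D mD; rewrite setTI; exists [set w : R -> R | D (w t)].
  by apply: sub_sigma_algebra; exists t, D.
by rewrite setTI.
Qed.

End cpath_pointed.

(** * Discounted rewards at hitting times *)

Section stopped.
Context {R : realType} (delta f : R -> R).
Hypothesis delta_c : cont0 delta.
Hypothesis mf : measurable_fun setT f.

(** The value [0] when [F] is never hit stands for the limit superior in [payoff], which is almost
    surely [0] once discounted rewards decay. *)
Definition stopped (F : set R) (w : R -> R) : R :=
  if hit F w is t%:E then delta t * f (w t) else 0.

(** [delta] is treated as a deterministic continuous path sampled at a random time. *)
Lemma measurable_discount d (S : measurableType d) (sg : S -> R) :
  (forall s, 0 <= sg s) -> measurable_fun setT sg ->
  measurable_fun setT (fun s => delta (sg s)).
Proof.
move=> sg0 msg; apply: (@measurable_sample _ _ _ (fun=> delta)) => //.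
Qed.

Lemma measurable_stopped d (S : measurableType d) (Y : S -> R -> R) (F : set R) :
  (forall s, cont0 (Y s)) -> closed F ->
  (forall t, 0 <= t -> measurable_fun setT (Y^~ t)) ->
  measurable_fun setT (fun s => stopped F (Y s)).
Proof.
move=> cY cF mY; pose T s := fine (hit F (Y s)).
have mh := measurable_hit cY mY cF.
have mT : measurable_fun setT T by exact: measurableT_comp.
have T0 s : 0 <= T s by rewrite fine_ge0// hit_ge0.
pose H := [set s | (hit F (Y s) < +oo)%E].
have mH : measurable H.
  by rewrite -[H]setTI; exact: emeasurable_fun_infty_o.
(* The indicator kills the arbitrary value that [fine] gives to an infinite hitting time. *)
have -> : (fun s => stopped F (Y s)) =
    (fun s => \1_H s * (delta (T s) * f (Y s (T s)))).
  apply/funext => s; rewrite /stopped /T indicE.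
  have [sH|sH] := boolP (s \in H).
    by rewrite mul1r; move: sH; rewrite inE => /hit_fin <-.
  rewrite mul0r; move: sH; rewrite notin_setE /H/=.
  by have := hit_ge0 F (Y s); case: (hit F (Y s)) => //= r _ []; rewrite ltry.
apply: measurable_funM; first exact: measurable_indic.
apply: measurable_funM; first exact: measurable_discount.
by apply: measurableT_comp => //; exact: measurable_sample.
Qed.

End stopped.

(** * Integration *)

Section trace_law.
Local Open Scope ereal_scope.
Context d d' (T : measurableType d) (U : measurableType d') (R : realType).
Variables (mu : {finite_measure set T -> \bar R}) (E : set T) (xi : T -> U).

(** The image under [xi] of the restriction of [mu] to [E], that is, an unnormalised conditional
    law. *)
Definition trace_law (mE : measurable E) (mxi : measurable_fun setT xi)
  (A : set U) := mu (E `&` xi @^-1` A).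

Variables (mE : measurable E) (mxi : measurable_fun setT xi).
Local Notation law := (trace_law mE mxi).

Let mpre A : measurable A -> measurable (xi @^-1` A).
Proof. by move=> mA; rewrite -[X in measurable X]setTI; exact: mxi. Qed.

Let law0 : law set0 = 0.
Proof. by rewrite /trace_law preimage_set0 setI0 measure0. Qed.

Let law_ge0 A : 0 <= law A.
Proof. exact: measure_ge0. Qed.

Let law_sigma_additive : semi_sigma_additive law.
Proof.
move=> F mF tF mUF; rewrite /trace_law preimage_bigcup setI_bigcupr.
apply: measure_semi_sigma_additive.
- by move=> n; apply: measurableI => //; exact: mpre.
- apply/trivIsetP => /= i j _ _ ij.
  rewrite setIACA -preimage_setI.
  by move/trivIsetP : tF => /(_ _ _ _ _ ij) ->//; rewrite preimage_set0 setI0.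
- rewrite -setI_bigcupr -preimage_bigcup; apply: measurableI => //.
  exact: mpre.
Qed.

HB.instance Definition _ := isMeasure.Build _ _ _
  law law0 law_ge0 law_sigma_additive.

Let law_fin : fin_num_fun law.
Proof.
by move=> A mA; apply: fin_num_measure; apply: measurableI => //; exact: mpre.
Qed.

HB.instance Definition _ := Measure_isFinite.Build _ _ _ law law_fin.

Lemma ge0_integral_trace_law (f : U -> \bar R) :
  measurable_fun setT f -> (forall y, 0 <= f y) ->
  \int[law]_y f y = \int[mu]_(x in E) f (xi x).
Proof.
move=> mf f0.
have mfx : measurable_fun setT (f \o xi) by exact: measurableT_comp.
transitivity (\int[pushforward (mrestr mu mE) xi]_y f y).
  by apply: eq_measure_integral => A mA _; rewrite /= /trace_law /pushforward /mrestr setIC.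
rewrite ge0_integral_pushforward// preimage_setT.
have -> : \int[mu]_(x in E) f (xi x) = \int[mrestr mu mE]_(x in E) f (xi x).
  by apply: eq_measure_integral => A mA AE; rewrite /= /mrestr setIidl.
rewrite (ge0_negligible_integral (measurableC mE))//=.
- by rewrite setTD setCK.
- by rewrite /mrestr setICl measure0.
Qed.

End trace_law.

Section independence.
Local Open Scope ereal_scope.
Context d d1 d2 (T : measurableType d) (U : measurableType d1)
  (W : measurableType d2) (R : realType).
Variables (mu : {finite_measure set T -> \bar R}) (nu : {finite_measure set W -> \bar R}).
Variables (E : set T) (xi : T -> U) (eta : T -> W).

(** By the hypothesis on rectangles and uniqueness of product measures, the joint law of [xi] and
    [eta] on [E] is the product of the trace law of [xi] with [nu]; Tonelli then separates the
    factors. *)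
Lemma ge0_integralM_indep (a : U -> R) (g : W -> R) :
  measurable E -> measurable_fun setT xi -> measurable_fun setT eta ->
  (forall A B, measurable A -> measurable B ->
    mu (E `&` (xi @^-1` A `&` eta @^-1` B)) = mu (E `&` xi @^-1` A) * nu B) ->
  measurable_fun setT a -> measurable_fun setT g ->
  (forall u, (0 <= a u)%R) -> (forall w, (0 <= g w)%R) ->
  \int[mu]_(x in E) (a (xi x) * g (eta x))%:E =
  (\int[mu]_(x in E) (a (xi x))%:E) * (\int[nu]_w (g w)%:E).
Proof.
move=> mE mxi meta indep ma mg a0 g0.
have mp : measurable_fun setT (fun x => (xi x, eta x)).
  exact: measurable_fun_pair.
have ma1 : measurable_fun setT (fun p : U * W => a p.1).
  exact: measurableT_comp.
have mg2 : measurable_fun setT (fun p : U * W => g p.2).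
  exact: measurableT_comp.
pose h (p : U * W) := (a p.1 * g p.2)%:E.
have mh : measurable_fun setT h by apply/measurable_EFinP; exact: measurable_funM.
have h0 p : 0 <= h p by rewrite lee_fin mulr_ge0.
rewrite -(ge0_integral_trace_law mu mE mp mh h0).
rewrite -(@ge0_integral_trace_law _ _ _ _ _ mu _ _ mE mxi (EFin \o a))//=; last 1 first.
- exact/measurable_EFinP.
transitivity (\int[trace_law mu mE mxi \x nu]_p h p).
  apply: eq_measure_integral => A mA _.
  by apply/esym; apply: product_measure_unique.
rewrite fubini_tonelli1//= -ge0_integralZr//; last 3 first.
- exact/measurable_EFinP.
- by move=> u _; rewrite lee_fin.
- by apply: integral_ge0 => w _; rewrite lee_fin.
apply: eq_integral => u _; rewrite -ge0_integralZl//.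
- exact/measurable_EFinP.
- by move=> w _; rewrite lee_fin.
- by rewrite lee_fin.
Qed.
End independence.

Section nonmeasurable_integrands.
Local Open Scope ereal_scope.
Context d (T : measurableType d) (R : realType).
Variable mu : {measure set T -> \bar R}.
Import HBNNSimple.

(* The payoff at the hitting time of a Borel set need not be measurable. *)
Lemma ge0_le_integral_off_null (D N : set T) (u v : T -> \bar R) :
  mu.-negligible N -> (forall x, 0 <= u x) -> (forall x, 0 <= v x) ->
  (forall x, D x -> ~ N x -> u x <= v x) ->
  \int[mu]_(x in D) u x <= \int[mu]_(x in D) v x.
Proof.
move=> [M [mM M0 NM]] u0 v0 uv; rewrite integral_mkcond [leRHS]integral_mkcond.
have uD0 x : 0 <= (u \_ D) x by apply: erestrict_ge0 => y _; exact: u0.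
have vD0 x : 0 <= (v \_ D) x by apply: erestrict_ge0 => y _; exact: v0.
rewrite !ge0_integralTE//.
apply: ge_ereal_sup => _ [h /= hu <-].
(* A simple function below [u] is cut to [0] on the null set [M]: it is then below [v] everywhere
   and keeps its integral. *)
apply: ereal_sup_ubound; exists (proj_nnsfun h (measurableC mM)).
  move=> x /=; rewrite /mindic indicE.
  have [xM|xM] := boolP (x \in ~` M); last by rewrite mulr0.
  rewrite mulr1; apply: le_trans (hu x) _; rewrite !patchE.
  case: ifPn => // /[!inE] Dx; apply: uv => // /NM.
  by move: xM; rewrite inE.
rewrite -!integralT_nnsfun; apply: ge0_ae_eq_integral => //.
- exact/measurable_EFinP.
- exact/measurable_EFinP.
- by move=> x _; rewrite lee_fin.
- by move=> x _; rewrite lee_fin.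
exists M; split => // x /= /not_implyP[_]; apply: contra_notP => Mx.
by rewrite /mindic indicE mem_set// mulr1.
Qed.

Lemma ge0_eq_integral_off_null (D N : set T) (u v : T -> \bar R) :
  mu.-negligible N -> (forall x, 0 <= u x) -> (forall x, 0 <= v x) ->
  (forall x, D x -> ~ N x -> u x = v x) ->
  \int[mu]_(x in D) u x = \int[mu]_(x in D) v x.
Proof.
move=> N0 u0 v0 uv; apply/eqP; rewrite eq_le; apply/andP.
by split; apply: (ge0_le_integral_off_null N0) => // x Dx /(uv _ Dx) ->.
Qed.

End nonmeasurable_integrands.

Section null_sets.
Local Open Scope ereal_scope.
Context d (T : measurableType d) (R : realType).
Variable mu : {measure set T -> \bar R}.

Lemma negligible_bigcup_rat (A : rat -> set T) : (forall q, mu.-negligible (A q)) ->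
  mu.-negligible (\bigcup_q A q).
Proof.
move=> A0; apply: (@negligibleS _ _ _ _
    (\bigcup_n (if unpickle n is Some q then A q else set0))).
  move=> w [q _ Aqw]; have := pickleK q; move: (pickle q) => n nq.
  by exists n; rewrite ?nq.
apply: negligible_bigcup => n; case: unpickle => [q|]; first exact: A0.
exact: negligible_set0.
Qed.

Lemma ge0_integral_eq0_negligible (D : set T) (g : T -> R) :
  measurable D -> measurable_fun setT g -> (forall x, (0 <= g x)%R) ->
  \int[mu]_(x in D) (g x)%:E = 0 -> mu.-negligible (D `&` [set x | (0 < g x)%R]).
Proof.
move=> mD mg g0 ig0.
have mgD : measurable_fun D (EFin \o g).
  by apply/measurable_EFinP; exact: measurable_funS mg.
move: (ae_eq_integral_abs mu mD mgD).1.
have -> : \int[mu]_(x in D) `|(EFin \o g) x| = 0.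
  by rewrite -[RHS]ig0; apply: eq_integral => x _; rewrite gee0_abs// lee_fin.
move=> /(_ erefl); apply: negligibleS => x /= [Dx gx] /(_ Dx) [] gx0.
by move: gx; rewrite gx0 ltxx.
Qed.

(** Were the inequality to fail, the positive part of [v - u] would have integral [0] because that
    of [u] is finite, and [B] would be negligible in [D]. *)
Lemma ge0_lt_integral (D N B : set T) (u v : T -> R) :
  measurable D -> mu.-negligible N ->
  measurable_fun setT u -> measurable_fun setT v ->
  (forall x, (0 <= u x)%R) -> (forall x, (0 <= v x)%R) ->
  (forall x, D x -> ~ N x -> (u x <= v x)%R) ->
  (forall x, D x -> B x -> ~ N x -> (u x < v x)%R) ->
  ~ mu.-negligible (D `&` B) -> \int[mu]_(x in D) (u x)%:E < +oo ->
  \int[mu]_(x in D) (u x)%:E < \int[mu]_(x in D) (v x)%:E.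
Proof.
move=> mD N0 mu_ mv u0 v0 uv uvlt nDB ioo; rewrite ltNge; apply/negP => vu.
apply: nDB; pose h x := Num.max (v x - u x)%R 0%R.
have h0 x : (0 <= h x)%R by rewrite le_max lexx orbT.
have mh : measurable_fun setT h.
  by apply: measurable_maxr => //; exact: measurable_funB.
have ui0 : 0 <= \int[mu]_(x in D) (u x)%:E.
  by apply: integral_ge0 => x _; rewrite lee_fin.
have : \int[mu]_(x in D) (u x)%:E + \int[mu]_(x in D) (h x)%:E <=
    \int[mu]_(x in D) (u x)%:E.
  rewrite -ge0_integralD//; last 4 first.
  - by move=> x _; rewrite lee_fin.
  - by apply/measurable_EFinP; exact: measurable_funS mu_.
  - by move=> x _; rewrite lee_fin.
  - by apply/measurable_EFinP; exact: measurable_funS mh.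
  apply: le_trans vu; apply: (ge0_le_integral_off_null N0).
  - by move=> x; rewrite -EFinD lee_fin addr_ge0.
  - by move=> x; rewrite lee_fin.
  - move=> x Dx Nx; rewrite -EFinD lee_fin /h max_l ?subr_ge0 ?uv//.
    by rewrite addrC subrK.
rewrite -[leRHS]adde0 leeD2lE ?ge0_fin_numE// => hle.
have hi0 : \int[mu]_(x in D) (h x)%:E = 0.
  apply/eqP; rewrite eq_le hle/=.
  by apply: integral_ge0 => x _; rewrite lee_fin.
apply: negligibleS (negligibleU N0 (ge0_integral_eq0_negligible mD mh h0 hi0)).
move=> x [Dx Bx]; have [|Nx] := pselect (N x); [by left|right; split => //=].
by rewrite lt_max subr_gt0 uvlt.
Qed.

End null_sets.

(** * The strong Markov property at hitting times of points *)

Section markov.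
Context (d : measure_display) (R : realType) (Omega : measurableType d).
Variables (XX : set R) (P : R -> probability Omega R) (X : R -> Omega -> R).
Hypothesis X_csm : continuous_strong_markov_process XX P X.

Definition traj (w : Omega) : cpath R := CPath (@csm_continuous _ _ _ _ _ _ X_csm w).

Lemma max0_ge0 (s : R) : 0 <= Num.max 0 s.
Proof. by rewrite le_max lexx. Qed.

(* Negative times are truncated to keep the shift total. *)
Definition shift (s : R) (w : cpath R) : cpath R :=
  CPath (cont0_shift (@cfun_cont _ w) (max0_ge0 s)).

Lemma shiftE s (w : cpath R) : 0 <= s -> shift s w = (fun t => w (s + t)) :> (R -> R).
Proof. by move=> s0; rewrite /= max_r. Qed.

Lemma measurable_X t : 0 <= t -> measurable_fun setT (X t).
Proof. exact: (csm_measurable X_csm). Qed.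

Lemma measurable_traj : measurable_fun setT traj.
Proof. by apply: measurable_cpath => t t0; exact: measurable_X. Qed.

Lemma measurable_shift_traj (sg : Omega -> R) :
  measurable_fun setT sg -> measurable_fun setT (fun w => shift (sg w) (traj w)).
Proof.
move=> msg; apply: measurable_cpath => t t0.
apply: (@measurable_sample _ _ _ (fun w => traj w) _ _ (fun w => Num.max 0 (sg w) + t)).
- by move=> w; exact: cfun_cont.
- exact: measurable_X.
- by move=> w; rewrite addr_ge0// max0_ge0.
- by apply: measurable_funD => //; exact: measurable_maxr.
Qed.

Lemma measurable_hit_traj F : closed F -> measurable_fun setT (fun w => hit F (traj w)).
Proof.
by move=> cF; apply: measurable_hit => // [w|]; [exact: cfun_cont|exact: measurable_X].
Qed.

Section filtration.
Variable t : R.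

Definition past : set_system Omega :=
  [set C | exists s (B : set R),
         [/\ 0 <= s, s <= t, measurable B & C = X s @^-1` B] ].

(** The sample space with only the past up to [t] as events, to which the general measurability
    lemmas then apply. *)
Let Omega_t := g_sigma_algebraType past.

Lemma measurable_past s : 0 <= s -> s <= t ->
  measurable_fun (setT : set Omega_t) (X s).
Proof.
move=> s0 st _ B mB; rewrite setTI; apply: sub_sigma_algebra.
by exists s, B.
Qed.

Lemma past_hit_lt F s : closed F -> s <= t ->
  natural_filtration X t [set w | (hit F (traj w) < s%:E)%E].
Proof.
move=> cF st; apply: (@measurable_hit_lt _ _ Omega_t (fun w => traj w)) => //.
- by move=> w; exact: cfun_cont.
- by move=> u u0 us; apply: measurable_past => //; rewrite (le_trans (ltW us)).
Qed.

Lemma past_hit_le F s : closed F -> s <= t ->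
  natural_filtration X t [set w | (hit F (traj w) <= s%:E)%E].
Proof.
move=> cF st; apply: (@measurable_hit_le _ _ Omega_t (fun w => traj w)) => //.
- by move=> w; exact: cfun_cont.
- by move=> u /andP[u0 us]; apply: measurable_past => //; rewrite (le_trans us).
Qed.

(** Only the truncation of a hitting time at [t] is determined by the past; thresholds above [t]
    give the sure event. *)
Lemma past_hit_min F : closed F ->
  measurable_fun (setT : set Omega_t) (fun w => mine (hit F (traj w)) t%:E).
Proof.
move=> cF; apply: (measurability _ (ErealGenInftyO.measurableE R)).
move=> _ -[_ [x ->]] <-; rewrite setTI.
have [tx|xt] := ltP t x.
  rewrite (_ : _ @^-1` _ = setT)//; apply/seteqP; split => // w _ /=.
  by rewrite in_itv/= gt_min lte_fin tx orbT.
rewrite (_ : _ @^-1` _ = [set w | (hit F (traj w) < x%:E)%E]); first exact: past_hit_lt.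
by apply/seteqP; split => w /=; rewrite in_itv/= gt_min lte_fin (ltNge t x) xt orbF.
Qed.

(** The comparison is witnessed by a rational [r < t] such that [a] is hit by time [r] and [F] only
    later. On the event the hitting time equals its truncation at [t], so membership in [D] is
    decided by the past as well. *)
Lemma past_hit_before a F (D : set R) : closed F -> measurable D ->
  natural_filtration X t
    ([set w | (hit [set a] (traj w) < hit F (traj w))%E] `&`
     [set w | D (fine (hit [set a] (traj w)))] `&`
     [set w | (hit [set a] (traj w) < t%:E)%E]).
Proof.
move=> cF mD; have ca : closed [set a] by exact: closed_eq.
rewrite (_ : _ `&` _ = (\bigcup_(r : rat) (if 0 <= (ratr r : R) < t then
   [set w | (hit [set a] (traj w) <= (ratr r)%:E)%E] `\`
   [set w | (hit F (traj w) <= (ratr r)%:E)%E] else set0)) `&`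
   ((fun w => fine (mine (hit [set a] (traj w)) t%:E)) @^-1` D)); last first.
  apply/seteqP; split => w.
    move=> [[/= aF Da] at_]; split; last by rewrite /= min_l// ltW.
    have : (hit [set a] (traj w) < mine (hit F (traj w)) t%:E)%E by rewrite lt_min aF.
    have : (-oo < mine (hit F (traj w)) t%:E)%E.
      by rewrite lt_min ltNyr andbT (lt_le_trans _ (hit_ge0 _ _))// ltNyr.
    have : (mine (hit F (traj w)) t%:E < +oo)%E by rewrite gt_min ltry orbT.
    case E : (mine (hit F (traj w)) t%:E) => [m| |]// _ _.
    move=> /hit_ltP[r [r0 rm ar]].
    have : ((ratr r)%:E < mine (hit F (traj w)) t%:E)%E by rewrite E lte_fin.
    rewrite lt_min lte_fin => /andP[rF rt].
    by exists r => //; rewrite r0 rt; split => //=; apply/negP; rewrite -ltNge.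
  move=> [[r _]]; case: ifPn => // /andP[r0 rt] [/= ar /negP].
  rewrite -ltNge => rF; have rte : ((ratr r)%:E < t%:E)%E by rewrite lte_fin.
  have at_ := le_lt_trans ar rte; rewrite min_l ?ltW// => Da.
  by split => //; split => //=; exact: le_lt_trans rF.
apply: (@measurableI _ Omega_t).
  apply: (@bigcupT_measurable_rat _ Omega_t) => r; case: ifPn => [/andP[r0 rt]|_].
    by apply: (@measurableD _ Omega_t); apply: past_hit_le => //; exact: ltW.
  exact: (@measurable0 _ Omega_t).
rewrite -[X in measurable X]setTI.
apply: (@measurableT_comp _ _ _ Omega_t _ _ (@fine R)) => //.
exact: past_hit_min.
Qed.

End filtration.

Lemma optional_hit F : closed F -> optional_time X (fun w => hit F (traj w)).
Proof.
move=> cF; split => [w|t t0]; first exact: hit_ge0.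
exact: past_hit_lt.
Qed.

Definition hit_before a F := [set w | (hit [set a] (traj w) < hit F (traj w))%E].

Lemma measurable_hit_before a F : closed F -> measurable (hit_before a F).
Proof.
move=> cF; rewrite -[X in measurable X]setTI; apply: emeasurable_fun_lt => //.
- by apply: measurable_hit_traj; exact: closed_eq.
- exact: measurable_hit_traj.
Qed.

Definition hit_time a w := fine (hit [set a] (traj w)).

Lemma measurable_hit_time a : measurable_fun setT (hit_time a).
Proof. by apply: measurableT_comp => //; apply: measurable_hit_traj; exact: closed_eq. Qed.

Lemma hit_time_ge0 a w : 0 <= hit_time a w.
Proof. by rewrite fine_ge0// hit_ge0. Qed.

Lemma hit_before_fin a F w : hit_before a F w -> hit [set a] (traj w) = (hit_time a w)%:E.
Proof.
by move=> aF; rewrite hit_fin// (lt_le_trans aF)// leey.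
Qed.

Lemma X_hit_time a F w : hit_before a F w -> X (hit_time a w) w = a.
Proof.
move=> /hit_before_fin /(hit_attained (@cfun_cont _ (traj w)) (@closed_eq R a)).
by case.
Qed.

(** At its hitting time the process is at [a], so the integrand of the strong Markov property is
    constant: on [hit_before a F] the shifted path is independent of the hitting time and has the
    law of the process started at [a]. *)
Lemma strong_markov_hit x a F (D : set R) (C : set (cpath R)) :
  XX x -> closed F -> measurable D -> measurable C ->
  P x (hit_before a F `&` (hit_time a @^-1` D `&`
       (fun w => shift (hit_time a w) (traj w)) @^-1` C)) =
  (P x (hit_before a F `&` hit_time a @^-1` D) * P a (traj @^-1` C))%E.
Proof.
move=> XXx cF mD /cpath_eventP[B eB CB].
pose L := hit_before a F `&` hit_time a @^-1` D.
have mL : measurable L.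
  apply: measurableI; first exact: measurable_hit_before.
  by rewrite -[X in measurable X]setTI; exact: measurable_hit_time.
have Lfin : L `&` [set w | (hit [set a] (traj w) < +oo)%E] = L.
  by apply/setIidl => w [aF _] /=; rewrite (hit_before_fin aF) ltry.
have LF : optional_events X (fun w => hit [set a] (traj w)) L.
  by split => // t t0; exact: past_hit_before.
have := csm_strong_markov X_csm XXx (optional_hit (@closed_eq R a)) LF eB.
rewrite Lfin.
have -> : [set w | B (fun t => X (fine (hit [set a] (traj w)) + t) w)] =
    (fun w => shift (hit_time a w) (traj w)) @^-1` C.
  apply/seteqP; split => w /=; rewrite CB/= /hit_time max_r//; exact: hit_time_ge0.
rewrite setIA => ->.
rewrite (eq_integral (fun=> P a (traj @^-1` C))).
  by rewrite integral_cst// muleC.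
move=> w; rewrite inE => -[aF _]; have -> := X_hit_time aF.
by congr (P a _); apply/seteqP; split => v /=; rewrite CB.
Qed.

(** The strong Markov property at the constant time [q], whose integrand vanishes wherever [X q]
    lies in [D]. *)
Lemma markov_null x q (D : set R) (C : set (cpath R)) :
  XX x -> 0 <= q -> measurable D -> measurable C ->
  (forall y, XX y -> D y -> P y (traj @^-1` C) = 0%E) ->
  P x (X q @^-1` D `&` (fun w => shift q (traj w)) @^-1` C) = 0%E.
Proof.
move=> XXx q0 mD /cpath_eventP[B eB CB] PC0.
have nF0 t A : natural_filtration X t (if A then setT else set0).
  by case: A; [exact: (@measurableT _ (g_sigma_algebraType (past t)))|
               exact: (@measurable0 _ (g_sigma_algebraType (past t)))].
have oq : optional_time X (fun=> q%:E).
  split => [w|t t0]; first by rewrite lee_fin.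
  rewrite (_ : [set _ | _] = if q < t then setT else set0); first exact: nF0.
  by apply/seteqP; split => w /=; rewrite lte_fin; case: ifP.
have mXq : measurable (X q @^-1` D).
  by rewrite -[X in measurable X]setTI; exact: measurable_X.
have LF : optional_events X (fun=> q%:E) (X q @^-1` D).
  split => // t t0; rewrite (_ : _ `&` _ = if q < t then X q @^-1` D else set0).
    case: ifPn => [qt|_]; last exact: (nF0 t false).
    by apply: sub_sigma_algebra; exists q, D; rewrite (ltW qt).
  by apply/seteqP; split => w /=; rewrite lte_fin; case: ifP => // _ [].
have := csm_strong_markov X_csm XXx oq LF eB.
have -> : [set _ : Omega | (q%:E < +oo)%E] = setT.
  by apply/seteqP; split => // w _ /=; rewrite ltry.
rewrite setIT.
have -> : [set w | B (fun t => X (fine q%:E + t) w)] =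
    (fun w => shift q (traj w)) @^-1` C.
  by apply/seteqP; split => w /=; rewrite CB/= max_r.
move=> ->; apply: integral0_eq => w Dw /=.
rewrite -[RHS](PC0 (X q w))//; last exact: (csm_state X_csm).
by congr (P _ _); apply/seteqP; split => v /=; rewrite CB.
Qed.

End markov.

(** * Pathwise decompositions: passing through a point and leaving a closed set for the last time *)

Section path_facts.
Context {R : realType}.
Implicit Types (w : cpath R) (F : set R) (a b c q s t u v y : R).

Lemma measurable_hit_before_path v F : closed F ->
  measurable [set w : cpath R | (hit [set v] w < hit F w)%E].
Proof.
move=> cF; rewrite -[X in measurable X]setTI; apply: emeasurable_fun_lt => //.
  apply: measurable_hit => [w|t t0|]; [exact: cfun_cont|exact: measurable_eval|].
  exact: closed_eq.
by apply: measurable_hit => [w|t t0|//]; [exact: cfun_cont|exact: measurable_eval].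
Qed.

Lemma hit_shift_le F w s : 0 <= s -> (s%:E <= hit F w)%E ->
  hit F w = (s%:E + hit F (shift s w))%E.
Proof.
move=> s0 sF; rewrite shiftE//; apply: hit_shift => // t t0 ts.
by apply: (before_hit t0); rewrite (lt_le_trans _ sF)// lte_fin.
Qed.

(** The far side of [u] as seen from [v]; the two disjuncts cover both orders of [u] and [v]. *)
Definition beyond v u : set R := [set y | (v < u < y) || (y < u < v)].

Lemma measurable_beyond v u : measurable (beyond v u).
Proof.
rewrite (_ : beyond v u = (if v < u then `]u, +oo[%classic else set0) `|`
  (if u < v then `]-oo, u[%classic else set0)).
  by apply: measurableU; case: ifPn.
apply/seteqP; split => y; rewrite /beyond/=.
  by move=> /orP[/andP[vu uy]|/andP[yu uv]];
    [left; rewrite vu|right; rewrite uv]; rewrite /= in_itv/= ?andbT.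
by case; case: ifPn => //= h; rewrite in_itv/= ?andbT => ->; rewrite ?orbT.
Qed.

(** By the intermediate value theorem [u] is crossed on the way to [v]. Up to that crossing neither
    [v] nor [F] has been met before it, so restarting there subtracts the same time from both
    hitting times. *)
Lemma hit_before_via F w v u : beyond v u (w 0) ->
  (hit [set v] w < hit F w)%E ->
  (hit [set u] w < hit F w)%E /\
  (hit [set v] (shift (fine (hit [set u] w)) w) <
    hit F (shift (fine (hit [set u] w)) w))%E.
Proof.
move=> b0 vF; have cw := @cfun_cont _ w.
have voo : (hit [set v] w < +oo)%E by rewrite (lt_le_trans vF)// leey.
have [tv0 wv] := hit_attained cw (@closed_eq R v) (esym (hit_fin voo)).
set tv := fine (hit [set v] w) in tv0 wv.
have [t /andP[t0 ttv] wt] : exists2 t, 0 <= t <= tv & w t = u.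
  apply: cont0_ivt => //; rewrite wv.
  by move: b0; rewrite /beyond/= => /orP[/andP[h1 h2]|/andP[h1 h2]]; apply/orP;
    [right|left]; rewrite !ltW.
have uv : (hit [set u] w <= hit [set v] w)%E.
  by rewrite -[leRHS]hit_fin// (le_trans (@hit_le _ [set u] w t t0 wt))// lee_fin.
have uF := le_lt_trans uv vF.
have uoo := lt_le_trans uF (leey _).
split=> //; set s := fine (hit [set u] w).
have s0 : 0 <= s by rewrite fine_ge0// hit_ge0.
have sE : hit [set u] w = s%:E by rewrite hit_fin.
move: vF; rewrite (@hit_shift_le [set v] _ s)// -?sE//.
by rewrite (@hit_shift_le F _ s)// -?sE ?ltW// sE lteD2lE.
Qed.

(** The time [q] is taken just after the last visit to [F] before the arrival at [v]. It is rational
    so that only countably many restart times are needed. *)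
Lemma last_exit F w u v : closed F -> w 0 = u -> u != v ->
  (forall z, (u <= z <= v) || (v <= z <= u) -> ~ F z) ->
  (hit [set v] w < +oo)%E -> (hit F w <= hit [set v] w)%E ->
  exists q : rat, [/\ 0 <= (ratr q : R), beyond v u (w (ratr q)) &
    (hit [set v] (shift (ratr q) w) < hit F (shift (ratr q) w))%E].
Proof.
move=> cF w0 uv nF voo Fv; have cw := @cfun_cont _ w.
have [t0 wt] := hit_attained cw (@closed_eq R v) (esym (hit_fin voo)).
set t := fine (hit [set v] w) in t0 wt.
have tE : hit [set v] w = t%:E by rewrite hit_fin.
have before_t s : 0 <= s -> s < t -> w s <> v.
  by move=> s0 st; apply: (@before_hit _ [set v] w s s0); rewrite tE lte_fin.
(* The path run backwards from its arrival at [v]: its first entrance into [F], at time [h], is the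
   last visit of [w] to [F], at time [l = t - h]. *)
pose r s := w (Num.max 0 (t - s)).
have cr : cont0 r.
  apply/cont0_max => s.
  apply: (@continuous_comp _ _ _ (fun s => t - Num.max 0 s) (fun s => w (Num.max 0 s))).
    apply: cvgB; first exact: cvg_cst.
    by apply: continuous_max; [exact: cvg_cst|exact: cvg_id].
  exact: (cont0_max _).1 cw _.
have [s0 [s00 s0t Fs0]] : exists t0, [/\ 0 <= t0, t0 <= t & F (w t0)].
  by apply: hit_le_ex => //; rewrite -tE.
have rle : (hit F r <= (t - s0)%:E)%E.
  apply: hit_le; first by rewrite subr_ge0.
  by rewrite /r max_r; rewrite subKr.
have roo : (hit F r < +oo)%E by rewrite (le_lt_trans rle)// ltry.
have [h0 Fh] := hit_attained cr cF (esym (hit_fin roo)).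
set h := fine (hit F r) in h0 Fh.
have hE : hit F r = h%:E by rewrite hit_fin.
have ht : h <= t by move: rle; rewrite hE lee_fin => /le_trans; apply; lra.
set l := t - h; have l0 : 0 <= l by rewrite subr_ge0.
have Fl : F (w l) by move: Fh; rewrite /r max_r.
have after_l s : l < s -> s <= t -> ~ F (w s).
  move=> ls st; have := @before_hit _ F r (t - s).
  rewrite subr_ge0 hE lte_fin => /(_ st); rewrite /r subKr max_r; last first.
    by rewrite (le_trans l0)// ltW.
  by apply; rewrite /l in ls; lra.
have lt_t : l < t.
  rewrite lt_neqAle; apply/andP; split; last by rewrite /l; lra.
  apply/eqP => lt_; move: Fl; rewrite lt_ wt; apply: nF.
  by have [uv_|/ltW vu_] := leP u v; rewrite ?lexx ?uv_ ?vu_ ?orbT.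
(* [w l] is in [F], hence not between [u] and [v]; nor is it on the far side of [v], since going
   there from [u] would cross [v] before [t]. *)
have bl : beyond v u (w l).
  have := nF (w l); rewrite /beyond/=.
  have no_ivt : ~ ((u <= v <= w l) \/ (w l <= v <= u)).
    move=> H; have [s /andP[s_0 sl] ws] : exists2 s, 0 <= s <= l & w s = v.
      by apply: cont0_ivt => //; rewrite w0; apply/orP.
    by apply: (before_t s s_0) ws; exact: le_lt_trans sl lt_t.
  have [uv'|vu] : u < v \/ v < u by move: uv; rewrite neq_lt => /orP.
    move=> nFl; apply/orP; right; apply/andP; split => //.
    rewrite ltNge; apply/negP => ul; have [lv|vl] := leP (w l) v.
      by apply: nFl => //; rewrite ul lv.
    by apply: no_ivt; left; rewrite !ltW.
  move=> nFl; apply/orP; left; apply/andP; split => //.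
  rewrite ltNge; apply/negP => lu; have [vl|lv] := leP v (w l).
    by apply: nFl => //; rewrite lu vl orbT.
  by apply: no_ivt; right; rewrite !ltW.
(* Being beyond [u] is an open condition, so it persists at times slightly after [l]. *)
have : \forall s \near l, beyond v u (w (Num.max 0 s)).
  have := (cont0_max _).1 cw l; rewrite /continuous_at max_r// => cwl.
  apply: cwl; move: bl; rewrite /beyond/= => /orP[/andP[vu uy]|/andP[yu uv']].
    near=> z; apply/orP; left; apply/andP; split => //; near: z; exact: lt_nbhsr.
  near=> z; apply/orP; right; apply/andP; split => //; near: z; exact: lt_nbhsl.
move=> /nbhs_ballP[e /= e0 He].
have [|q] := @rat_in_itvoo R l (Num.min t (l + e)).
  by rewrite lt_min lt_t ltrDl.
rewrite in_itv/= lt_min => /andP[lq /andP[qt qe]].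
have q0 : 0 <= ratr q :> R by rewrite (le_trans l0)// ltW.
exists q; split => //.
  have := He (ratr q); rewrite max_r//; apply.
  by rewrite /ball/= ltr0_norm; lra.
rewrite (@le_lt_trans _ _ (t - ratr q)%:E)//.
  rewrite (max_r q0); apply: hit_le; first by rewrite subr_ge0 ltW.
  by rewrite addrC subrK.
rewrite ltNge; apply/negP => /(hit_le_ex (@cfun_cont _ (shift (ratr q) w)) cF)[s [s_0 st]].
rewrite shiftE//; apply: after_l.
  by rewrite (lt_le_trans lq)// lerDl.
by rewrite -lerBrDl.
Unshelve. all: by end_near. Qed.

End path_facts.

(** * Reaching a point before a closed set with positive probability *)

Section hitting.
Context (d : measure_display) (R : realType) (Omega : measurableType d).
Variables (XX : set R) (P : R -> probability Omega R) (X : R -> Omega -> R).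
Hypothesis X_csm : continuous_strong_markov_process XX P X.

Local Notation traj := (traj X_csm).
Local Notation hit_before := (hit_before X_csm).
Local Notation hit_time := (hit_time X_csm).

Lemma start_null x : XX x -> (P x).-negligible [set w | X 0 w <> x].
Proof.
move=> XXx; have m0 : measurable [set w | X 0 w = x].
  rewrite -[X in measurable X]setTI.
  exact: (measurable_X X_csm (lexx 0) measurableT (measurable_set1 x)).
apply/negligibleP; first exact: measurableC.
have := probability_setC (P x) m0; rewrite (csm_start X_csm XXx) subee//.
Qed.

Lemma hit_before_null x a F (C : set (cpath R)) :
  XX x -> closed F -> measurable C ->
  (P a (traj @^-1` C) = 0)%E ->
  (P x).-negligible (hit_before a F `&`
     (fun w => shift (hit_time a w) (traj w)) @^-1` C).
Proof.
move=> XXx cF mC PC; apply/negligibleP.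
  apply: measurableI; first exact: measurable_hit_before.
  rewrite -[X in measurable X]setTI; apply: measurable_shift_traj => //.
  exact: measurable_hit_time.
have := strong_markov_hit X_csm a XXx cF (@measurableT _ R) mC.
by rewrite preimage_setT setTI => h; apply: etrans h _; rewrite PC mule0.
Qed.

(* If [v] could not be hit before [F] from [u], then almost surely every path
   from [u] to [v] visits [F] on the way; after its last visit to [F] it is
   beyond [u], as seen from [v], and reaches [v] without returning to [F], so
   such a passage has positive probability from some point beyond [u]. It goes
   through [u], which contradicts the strong Markov property at that time. *)
Lemma hit_before_gt0 (u v : R) F : regular XX P X ->
  XX° u -> XX v -> closed F -> u != v ->
  (forall z, (u <= z <= v) || (v <= z <= u) -> ~ F z) ->
  (0 < P u (hit_before v F))%E.
Proof.
move=> X_reg iu XXv cF uv nF; have XXu := interior_subset iu.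
rewrite lt0e measure_ge0 andbT; apply/eqP => Puv.
pose C := [set w : cpath R | (hit [set v] w < hit F w)%E].
have mC : measurable C by exact: measurable_hit_before_path.
have beyond_null y : XX y -> beyond v u y -> P y (traj @^-1` C) = 0%E.
  move=> XXy by_; apply/negligibleP.
    rewrite -[X in measurable X]setTI; exact: measurable_traj.
  apply: negligibleS (negligibleU (start_null XXy) (hit_before_null XXy cF mC Puv)).
  move=> w vF; have [w0|] := pselect (X 0 w = y); last by left.
  by right; apply: hit_before_via vF; rewrite /= w0.
have Nq q : (P u).-negligible (if 0 <= (ratr q : R) then X (ratr q) @^-1` beyond v u `&`
    (fun w => shift (ratr q) (traj w)) @^-1` C else set0).
  case: ifPn => [q0|_]; last exact: negligible_set0.
  apply/negligibleP.
    apply: measurableI; rewrite -[X in measurable X]setTI.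
      by apply: (measurable_X X_csm q0) => //; exact: measurable_beyond.
    by apply: measurable_shift_traj.
  exact: markov_null (measurable_beyond _ _) mC beyond_null.
have : (P u).-negligible [set w | (point_hitting_time X v w < +oo)%E].
  have PuN : (P u).-negligible (hit_before v F).
    by apply/negligibleP => //; exact: measurable_hit_before.
  apply: negligibleS (negligibleU (start_null XXu)
    (negligibleU PuN (negligible_bigcup_rat Nq))) => w /= voo.
  have [w0|] := pselect (X 0 w = u); last by left.
  right; have [vF|Fv] := ltP (hit [set v] (traj w)) (hit F (traj w)); first by left.
  right; have [q [q0 bq Cq]] := @last_exit _ F (traj w) u v cF w0 uv nF voo Fv.
  by exists q => //; rewrite q0.
have mv : measurable [set w | (point_hitting_time X v w < +oo)%E].
  rewrite -[X in measurable X]setTI; apply: emeasurable_fun_infty_o => //.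
  exact: (measurable_hit_traj X_csm (@closed_eq R v)).
move=> /(negligibleP _ mv) Pv0.
by have := X_reg _ _ iu XXv; rewrite Pv0 ltxx.
Qed.

End hitting.

(** * Payoffs and equilibria *)

Section payoffs.
Context (d : measure_display) (R : realType) (Omega : measurableType d).
Variables (XX : set R) (P : R -> probability Omega R) (X : R -> Omega -> R).
Variables (f delta : R -> R).
Hypothesis XX_itv : is_interval XX.
Hypothesis X_csm : continuous_strong_markov_process XX P X.
Hypothesis f_ge0 : forall x, XX x -> 0 <= f x.
Hypothesis f_cont : {within XX, continuous f}.
Hypothesis delta_disc : discount_function delta.
Hypothesis payoff_cvg0 : forall x, XX x ->
     {ae P x, forall w, delta t * f (X t w) @[t --> +oo] --> 0}.
Hypothesis delta_dec : forall s t, 0 < s -> 0 < t -> delta s * delta t < delta (s + t).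

Local Notation traj := (traj X_csm).
Local Notation hit_before := (hit_before X_csm).
Local Notation hit_time := (hit_time X_csm).

(** Extending [f] by [0] off [XX] gives a nonnegative measurable function on the whole line, and the
    process never leaves [XX]. *)
Definition state_payoff : R -> R := f \_ XX.
Local Notation fX := state_payoff.

Lemma state_payoffE x : XX x -> fX x = f x.
Proof. by move=> XXx; rewrite /fX patchE mem_set. Qed.

Lemma state_payoff_ge0 x : 0 <= fX x.
Proof. by rewrite /fX patchE; case: ifPn => // /[!inE]; exact: f_ge0. Qed.

Lemma measurable_state_payoff : measurable_fun setT fX.
Proof.
have mXX : measurable XX by exact: is_interval_measurable.
apply/(measurable_restrictT _ mXX).
exact: subspace_continuous_measurable_fun.
Qed.

Lemma discount_gt0 t : 0 <= t -> 0 < delta t.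
Proof. by move=> t0; have /andP[] := discount_range delta_disc t0. Qed.

Lemma discount_cont0 : cont0 delta.
Proof. exact: (discount_continuous delta_disc). Qed.

Lemma discount_le s t : 0 <= s -> 0 <= t -> delta s * delta t <= delta (s + t).
Proof.
rewrite le_eqVlt => /orP[/eqP<-|s0]; first by rewrite (discount0 delta_disc) mul1r add0r.
rewrite le_eqVlt => /orP[/eqP<-|t0]; first by rewrite (discount0 delta_disc) mulr1 addr0.
by rewrite ltW// delta_dec.
Qed.

Definition gain (F : set R) (w : R -> R) : R := stopped delta fX F w.

Lemma gain_ge0 F w : 0 <= gain F w.
Proof.
rewrite /gain /stopped; have := hit_ge0 F w; case: (hit F w) => // t.
by rewrite lee_fin => t0; rewrite mulr_ge0 ?state_payoff_ge0// ltW// discount_gt0.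
Qed.

Lemma measurable_gain F : closed F -> measurable_fun setT (fun w : cpath R => gain F w).
Proof.
move=> cF; apply: measurable_stopped => //.
- exact: discount_cont0.
- exact: measurable_state_payoff.
- by move=> w; exact: cfun_cont.
- by move=> t; exact: measurable_eval.
Qed.

Lemma measurable_gain_traj F : closed F -> measurable_fun setT (fun w => gain F (traj w)).
Proof.
by move=> cF; apply: (measurableT_comp (measurable_gain cF)); exact: measurable_traj.
Qed.

Lemma measurable_gain_gt0 F : closed F ->
  measurable [set w : cpath R | 0 < gain F w].
Proof.
move=> cF.
rewrite (_ : [set _ | _] = (fun w : cpath R => gain F w) @^-1` `]0, +oo[).
  by rewrite -[X in measurable X]setTI; exact: measurable_gain.
by apply/seteqP; split => w /=; rewrite in_itv/= andbT.
Qed.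

Lemma integral_gain_eq0 F c : closed F ->
  P c (traj @^-1` [set w : cpath R | 0 < gain F w]) = 0%E ->
  (\int[P c]_w (gain F (traj w))%:E = 0)%E.
Proof.
move=> cF c0; rewrite -[RHS](integral0 (P c) setT).
apply: (@ge0_eq_integral_off_null _ _ _ _ _ (traj @^-1` [set w : cpath R | 0 < gain F w])) => //.
- apply/negligibleP => //; rewrite -[X in measurable X]setTI.
  by apply: (measurable_traj X_csm) => //; exact: measurable_gain_gt0.
- by move=> w; rewrite lee_fin gain_ge0.
- move=> w _ /negP; rewrite -leNgt => g0; congr EFin; apply/eqP.
  by rewrite eq_le g0 gain_ge0.
Qed.

(** Up to time [s] the set has not been met, so the reward is the same; only the product of two
    discounts is compared with the discount of the sum. *)
Lemma gain_shift_le F (w : cpath R) s : 0 <= s -> (s%:E <= hit F w)%E ->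
  delta s * gain F (shift s w) <= gain F w.
Proof.
move=> s0 sF; rewrite /gain /stopped (hit_shift_le s0 sF).
have := hit_ge0 F (shift s w); case: (hit F (shift s w)) => //= [t|_].
  rewrite lee_fin => t0; rewrite max_r// mulrA ler_wpM2r ?state_payoff_ge0//.
  exact: discount_le.
by rewrite mulr0.
Qed.

(** Strictness needs both delays and the reward to be positive. *)
Lemma gain_shift_lt F (w : cpath R) s : 0 < s -> (s%:E <= hit F w)%E ->
  (0 < hit F (shift s w))%E -> 0 < gain F (shift s w) ->
  delta s * gain F (shift s w) < gain F w.
Proof.
move=> s0 sF; rewrite /gain /stopped (hit_shift_le (ltW s0) sF).
case: (hit F (shift s w)) => //= [t|_]; last by rewrite ltxx.
rewrite lte_fin max_r ?ltW// => t0; rewrite pmulr_rgt0 ?discount_gt0 ?ltW// => f0.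
by rewrite mulrA ltr_pM2r// delta_dec.
Qed.

Lemma payoff_ge0 A w : (0 <= payoff X f delta A w)%E.
Proof.
rewrite /payoff; have : (0 <= rho X A w)%E.
  by apply: le_ereal_inf_tmp => _ [t [t0 _] <-]; rewrite lee_fin ltW.
case: (rho X A w) => // [t|_].
  rewrite !lee_fin => t0; rewrite mulr_ge0 ?f_ge0 ?ltW ?discount_gt0//.
  exact: (csm_state X_csm).
apply: le_ereal_inf_tmp => _ [V [M [Mr HM]] <-].
apply: le_trans (ereal_sup_ubound _); last first.
  (* A time beyond [M] that is also nonnegative, so that the state lies in [XX] and [f] is
     nonnegative there. *)
  exists (Num.max 0 (M + 1)) => //; apply: HM.
  by rewrite lt_max ltrDl ltr01 orbT.
rewrite lee_fin mulr_ge0 ?f_ge0 ?ltW ?discount_gt0 ?max0_ge0//.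
by apply: (csm_state X_csm); exact: max0_ge0.
Qed.

Lemma limf_esup_cvg0 (u : R -> R) : u t @[t --> +oo] --> 0 ->
  (limf_esup (fun t => (u t)%:E) (pinfty_nbhs R) <= 0)%E.
Proof.
move=> /cvgrPdist_le u0; apply/lee_addgt0Pr => e e0; rewrite add0e.
apply: (@le_trans _ _ (ereal_sup ((fun t => (u t)%:E) @` [set t | `|0 - u t| <= e]))).
  by apply: ereal_inf_lbound; exists [set t | `|0 - u t| <= e] => //; exact: u0.
apply: ge_ereal_sup => _ [t /= ut <-]; rewrite lee_fin.
by apply: le_trans ut; rewrite sub0r normrN ler_norm.
Qed.

Lemma closed_inE (A : set R) : closed_in XX A -> A = XX `&` closure A.
Proof.
move=> [F cF AF]; apply/seteqP; split => [z Az|z [XXz clA]].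
  by split; [move: Az; rewrite AF => -[]|exact: subset_closure].
rewrite AF; split => //; rewrite (closure_id F).1//; apply: closure_subset clA.
by rewrite AF => y [].
Qed.

(** Starting outside [A], excluding time [0] changes nothing; and on states in [XX] a relatively
    closed set agrees with its closure. *)
Lemma rho_hit (A : set R) w : closed_in XX A -> ~ A (X 0 w) ->
  rho X A w = hit (closure A) (traj w).
Proof.
move=> cA nA0; rewrite /rho /hit; congr (ereal_inf (EFin @` _)).
apply/seteqP; split => t /= [t0].
  by rewrite {1}(closed_inE cA) => -[_ clA]; rewrite ltW.
move=> clA; have XXt : XX (X t w) by exact: (csm_state X_csm).
split; last by rewrite (closed_inE cA).
rewrite lt_neqAle t0 andbT; apply/eqP => t0E; apply: nA0.
by rewrite (closed_inE cA) t0E.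
Qed.

Lemma payoff_gain (A : set R) w : closed_in XX A -> ~ A (X 0 w) ->
  delta t * f (X t w) @[t --> +oo] --> 0 ->
  payoff X f delta A w = (gain (closure A) (traj w))%:E.
Proof.
move=> cA nA0 u0; have := payoff_ge0 A w; rewrite /payoff /gain /stopped rho_hit//.
have := hit_ge0 (closure A) (traj w).
case: (hit _ _) => // [t|_ l0].
  by rewrite lee_fin => t0 _; rewrite state_payoffE//; exact: (csm_state X_csm).
by apply/eqP; rewrite eq_le l0 andbT; exact: limf_esup_cvg0.
Qed.

(** This replaces the payoff by a measurable path functional. The exceptional null set collects the
    paths not starting at [z] and those whose discounted reward does not tend to [0]. *)
Lemma J_gain (A : set R) z : closed_in XX A -> XX z -> ~ A z ->
  J P X f delta z A = (\int[P z]_w (gain (closure A) (traj w))%:E)%E.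
Proof.
move=> cA XXz nAz.
apply: (ge0_eq_integral_off_null
  (negligibleU (start_null X_csm XXz) (payoff_cvg0 XXz))).
- by move=> w; exact: payoff_ge0.
- by move=> w; rewrite lee_fin gain_ge0.
move=> w _ nNw; apply: payoff_gain => //.
  have -> // : X 0 w = z; apply: contrapT => w0; apply: nNw; by left.
by apply: contrapT => u0; apply: nNw; right.
Qed.

(* [c] is the point of [T] closest to [x0] on one side, and [G] contains the
   points of [T] on the other side. *)
Record nearest (T : set R) (x0 c : R) (G : set R) : Prop := Nearest {
  nearest_state : XX c ;
  nearest_mem : T c ;
  nearest_neq : c != x0 ;
  nearest_closed : closed G ;
  nearest_sub : G `<=` T ;
  nearest_avoid : forall z, (x0 <= z <= c) || (c <= z <= x0) -> ~ G z ;
  nearest_cover : forall z, XX z -> T z ->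
    G z \/ (z <= c <= x0) || (x0 <= c <= z) }.

Lemma nearest_notin T x0 c G : nearest T x0 c G -> ~ G c.
Proof.
move=> /nearest_avoid; apply; rewrite lexx ?andbT.
by have [_|/ltW->] := leP x0 c; rewrite ?orbT.
Qed.

(** A visit to [T] before [c] would be in [G], which is met later, or on the far side of [c], which
    cannot be reached without crossing [c]. *)
Lemma nearest_hit T x0 c G w : nearest T x0 c G -> X 0 w = x0 ->
  hit_before c G w -> hit T (traj w) = (hit_time c w)%:E.
Proof.
move=> nT w0 cG; have Xc := X_hit_time cG.
have tc0 := hit_time_ge0 X_csm c w; have tcE := hit_before_fin cG.
apply/eqP; rewrite eq_le; apply/andP; split.
  by apply: hit_le => //=; rewrite Xc; exact: nearest_mem nT.
apply: le_ereal_inf_tmp => _ [t [t0 Tt] <-]; rewrite lee_fin leNgt; apply/negP => ttc.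
have [Gt|btw] := nearest_cover nT (csm_state X_csm w t0) Tt.
  have : (hit G (traj w) <= t%:E)%E by exact: hit_le.
  rewrite leNgt => /negP; apply; apply: lt_trans cG.
  by rewrite tcE lte_fin.
have [s /andP[s0 st] ws] : exists2 s, 0 <= s <= t & traj w s = c.
  by apply: cont0_ivt => //; [exact: cfun_cont|rewrite /= w0 orbC].
have := @hit_le _ [set c] (traj w) s s0 ws.
by rewrite tcE lee_fin leNgt (le_lt_trans st ttc).
Qed.

(** On the side of [c], continuity forces the first contact with [T] to be at [c] itself, and [c] is
    not in [G]. *)
Lemma nearest_first T x0 c G w t : closed T -> nearest T x0 c G -> X 0 w = x0 ->
  hit T (traj w) = t%:E ->
  (X t w <= c <= x0) || (x0 <= c <= X t w) -> hit_before c G w.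
Proof.
move=> cT nT w0 tE btw.
have [t0 Tt] := hit_attained (@cfun_cont _ (traj w)) cT tE.
have [s /andP[s0 st] ws] : exists2 s, 0 <= s <= t & traj w s = c.
  by apply: cont0_ivt => //; [exact: cfun_cont|rewrite /= w0 orbC].
have ts r : 0 <= r -> T (traj w r) -> t <= r.
  by move=> r0 Tr; rewrite -lee_fin -tE; exact: hit_le.
have st_ : s = t.
  by apply/eqP; rewrite eq_le st ts// ws; exact: nearest_mem nT.
rewrite /hit_before/= (@le_lt_trans _ _ t%:E)//.
  by rewrite -st_; apply: (@hit_le _ [set c]).
rewrite ltNge; apply/negP => /(hit_le_ex (@cfun_cont _ (traj w)) (nearest_closed nT)).
move=> [r [r0 rt Gr]]; apply: (nearest_notin nT).
have <- // : traj w r = c.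
rewrite -ws st_; congr (traj w _); apply/eqP; rewrite eq_le rt ts//.
exact: nearest_sub nT _ Gr.
Qed.

Lemma gain_nearest T x0 c G w : nearest T x0 c G -> X 0 w = x0 ->
  hit_before c G w -> gain T (traj w) = delta (hit_time c w) * f c.
Proof.
move=> nT w0 cG; rewrite /gain /stopped (nearest_hit nT w0 cG)/=.
by rewrite (X_hit_time cG) state_payoffE//; exact: nearest_state nT.
Qed.

Lemma measurable_delta_hit c : measurable_fun setT (fun w => delta (hit_time c w)).
Proof.
apply: measurable_discount; first exact: discount_cont0.
  by move=> w; exact: hit_time_ge0.
exact: measurable_hit_time.
Qed.

Lemma delta_hit_ge0 c w : 0 <= delta (hit_time c w).
Proof. by rewrite ltW// discount_gt0// hit_time_ge0. Qed.

Lemma integral_gain_nearest T x0 c G : XX x0 -> nearest T x0 c G ->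
  (\int[P x0]_(w in hit_before c G) (gain T (traj w))%:E =
   \int[P x0]_(w in hit_before c G) (delta (hit_time c w))%:E * (f c)%:E)%E.
Proof.
move=> XXx0 nT; have fc0 := f_ge0 (nearest_state nT).
rewrite -ge0_integralZr//; last 3 first.
- exact: (measurable_hit_before X_csm c (nearest_closed nT)).
- by apply/measurable_EFinP; apply: measurable_funS (measurable_delta_hit c).
- by move=> w _; rewrite lee_fin delta_hit_ge0.
apply: (ge0_eq_integral_off_null (start_null X_csm XXx0)).
- by move=> w; rewrite lee_fin gain_ge0.
- by move=> w; rewrite mule_ge0// lee_fin// delta_hit_ge0.
move=> w cG nw0; rewrite (gain_nearest nT)//.
exact: contrapT.
Qed.

(** Although [f] may be unbounded, on this event the gain is at most the single value [f c]. *)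
Lemma integral_gain_nearest_lty T x0 c G : XX x0 -> nearest T x0 c G ->
  (\int[P x0]_(w in hit_before c G) (gain T (traj w))%:E < +oo)%E.
Proof.
move=> XXx0 nT; rewrite integral_gain_nearest//.
have mE := measurable_hit_before X_csm c (nearest_closed nT).
apply: lte_mul_pinfty; rewrite ?ltry//.
  by apply: integral_ge0 => w _; rewrite lee_fin delta_hit_ge0.
rewrite ge0_fin_numE; last by apply: integral_ge0 => w _; rewrite lee_fin delta_hit_ge0.
apply: (@le_lt_trans _ _ (\int[P x0]_(w in hit_before c G) cst 1%E w)%E).
  apply: (@ge0_le_integral_off_null _ _ _ _ _ set0) => //.
  - exact: negligible_set0.
  - by move=> w; rewrite lee_fin delta_hit_ge0.
  - move=> w _ _; rewrite lee_fin.
    by have /andP[] := discount_range delta_disc (hit_time_ge0 X_csm c w).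
by rewrite integral_cst// mul1e (le_lt_trans (probability_le1 _ mE))// ltry.
Qed.

(** * Comparison of [T] with a smaller set [F] on the event that [c] is met first *)

Section comparison.
Variables (T F : set R) (x0 c : R) (G : set R).
Hypotheses (cT : closed T) (cF : closed F) (FT : F `<=` T).
Hypotheses (XXx0 : XX x0) (nT : nearest T x0 c G).

(** The reward for restarting at [c] towards [F], with the two discount factors multiplied. *)
Let later w := delta (hit_time c w) * gain F (shift (hit_time c w) (traj w)).

Let later_ge0 w : 0 <= later w.
Proof. by rewrite mulr_ge0 ?delta_hit_ge0 ?gain_ge0. Qed.

Let measurable_later : measurable_fun setT later.
Proof.
apply: measurable_funM; first exact: measurable_delta_hit.
apply: (measurableT_comp (measurable_gain cF)).
by apply: measurable_shift_traj; exact: measurable_hit_time.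
Qed.

(** When [c] is in [F], both sets are entered at the same time. *)
Lemma integral_gain_nearest_mem : F c ->
  (\int[P x0]_(w in hit_before c G) (gain T (traj w))%:E <=
   \int[P x0]_(w in hit_before c G) (gain F (traj w))%:E)%E.
Proof.
move=> Fc; apply: (ge0_le_integral_off_null (start_null X_csm XXx0)).
- by move=> w; rewrite lee_fin gain_ge0.
- by move=> w; rewrite lee_fin gain_ge0.
move=> w cG /contrapT w0; rewrite lee_fin le_eqVlt; apply/orP; left.
rewrite /gain /stopped (_ : hit F _ = hit T (traj w))//.
rewrite (nearest_hit nT w0 cG); apply/eqP; rewrite eq_le; apply/andP; split.
  by apply: hit_le; [exact: hit_time_ge0|rewrite /= (X_hit_time cG)].
rewrite -(nearest_hit nT w0 cG); apply: le_ereal_inf_tmp => _ [t [t0 Ft] <-].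
by apply: hit_le => //; exact: FT.
Qed.

Hypothesis fcE : (f c)%:E = (\int[P c]_w (gain F (traj w))%:E)%E.

(** By independence of the hitting time and the path after it, the integral factors; the second
    factor is the expected gain from [c], equal to [f c] by [fcE]. *)
Let integral_later :
  (\int[P x0]_(w in hit_before c G) (later w)%:E =
   \int[P x0]_(w in hit_before c G) (gain T (traj w))%:E)%E.
Proof.
have mtraj := measurable_traj X_csm.
have mg : measurable_fun setT (fun w : cpath R => (gain F w)%:E).
  by apply/measurable_EFinP; exact: measurable_gain.
have mE := measurable_hit_before X_csm c (nearest_closed nT).
rewrite integral_gain_nearest// fcE.
rewrite -(ge0_integral_trace_law (P c) (measurableT : measurable [set: Omega]) mtraj mg); last first.
  by move=> w; rewrite lee_fin gain_ge0.
(* [delta] is only controlled at nonnegative times; [a] is nonnegative and measurable on the whole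
   line. *)
pose a (s : R) := delta (Num.max 0 s).
have ma : measurable_fun setT a.
  apply: (measurable_discount discount_cont0); first exact: max0_ge0.
  exact: measurable_maxr.
have aE w : a (hit_time c w) = delta (hit_time c w).
  by rewrite /a max_r// hit_time_ge0.
transitivity (\int[P x0]_(w in hit_before c G) (a (hit_time c w) *
    gain F (shift (hit_time c w) (traj w)))%:E)%E.
  by apply: eq_integral => w _; rewrite aE.
transitivity (\int[P x0]_(w in hit_before c G) (a (hit_time c w))%:E *
    \int[trace_law (P c) (measurableT : measurable [set: Omega]) mtraj]_w (gain F w)%:E)%E.
  apply: (@ge0_integralM_indep _ _ _ _ _ _ R (P x0)
    (trace_law (P c) (measurableT : measurable [set: Omega]) mtraj)
    (hit_before c G) (hit_time c) (fun w => shift (hit_time c w) (traj w)) a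
    (fun w : cpath R => gain F w)) => //.
  - exact: measurable_hit_time.
  - by apply: measurable_shift_traj; exact: measurable_hit_time.
  - move=> A B mA mB; rewrite /= /trace_law setTI.
    exact: (strong_markov_hit X_csm c XXx0 (nearest_closed nT) mA mB).
  - exact: measurable_gain.
  - by move=> s; rewrite ltW// discount_gt0// max0_ge0.
  - by move=> w; exact: gain_ge0.
by congr (_ * _)%E; apply: eq_integral => w _; rewrite aE.
Qed.

Let later_le w : ~ F c -> X 0 w = x0 -> hit_before c G w ->
  later w <= gain F (traj w).
Proof.
move=> Fc w0 cG; apply: gain_shift_le; first exact: hit_time_ge0.
rewrite -(nearest_hit nT w0 cG); apply: le_ereal_inf_tmp => _ [t [t0 Ft] <-].
by apply: hit_le => //; exact: FT.
Qed.

(** Both delays are positive: the path has to move from [x0] to [c], which differ, and then from [c]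
    into the closed set [F], which misses [c]. *)
Let later_lt w : ~ F c -> X 0 w = x0 -> hit_before c G w ->
  0 < gain F (shift (hit_time c w) (traj w)) -> later w < gain F (traj w).
Proof.
move=> Fc w0 cG g0; have Xc := X_hit_time cG.
have ht0 := hit_time_ge0 X_csm c w.
apply: gain_shift_lt => //.
- rewrite lt_neqAle ht0 andbT eq_sym; apply/eqP => h0.
  by move: Xc (nearest_neq nT); rewrite h0 w0 => ->; rewrite eqxx.
- rewrite -(nearest_hit nT w0 cG); apply: le_ereal_inf_tmp => _ [t [t0 Ft] <-].
  by apply: hit_le => //; exact: FT.
rewrite lt_neqAle hit_ge0 andbT; apply/eqP => h0.
have [_] := hit_attained (@cfun_cont _ (shift (hit_time c w) (traj w))) cF (esym h0).
by rewrite shiftE// addr0 /= Xc.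
Qed.

Lemma integral_gain_nearest_le : ~ F c ->
  (\int[P x0]_(w in hit_before c G) (gain T (traj w))%:E <=
   \int[P x0]_(w in hit_before c G) (gain F (traj w))%:E)%E.
Proof.
move=> Fc; rewrite -integral_later.
apply: (ge0_le_integral_off_null (start_null X_csm XXx0)).
- by move=> w; rewrite lee_fin.
- by move=> w; rewrite lee_fin gain_ge0.
- by move=> w cG nw0; rewrite lee_fin later_le//; exact: contrapT.
Qed.

(** As [f c > 0] is the expected gain from [c], that gain is positive with positive probability. By
    the strong Markov property so is the gain of the shifted path on the event, and there the
    comparison is strict. *)
Lemma integral_gain_nearest_lt : ~ F c -> 0 < f c ->
  (0 < P x0 (hit_before c G))%E ->
  (\int[P x0]_(w in hit_before c G) (gain T (traj w))%:E <
   \int[P x0]_(w in hit_before c G) (gain F (traj w))%:E)%E.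
Proof.
move=> Fc fc0 PE; have mE := measurable_hit_before X_csm c (nearest_closed nT).
pose C := [set w : cpath R | 0 < gain F w].
have mC : measurable C by exact: measurable_gain_gt0.
have PC : (0 < P c (traj @^-1` C))%E.
  rewrite lt0e measure_ge0 andbT; apply/eqP => /(integral_gain_eq0 cF).
  by rewrite -fcE => -[] fc_eq0; move: fc0; rewrite fc_eq0 ltxx.
rewrite -integral_later.
apply: (@ge0_lt_integral _ _ _ _ _ [set w | X 0 w <> x0]
  ((fun w => shift (hit_time c w) (traj w)) @^-1` C)) => //.
- exact: (start_null X_csm XXx0).
- exact: measurable_gain_traj.
- by move=> w; exact: gain_ge0.
- by move=> w cG nw0; rewrite later_le//; exact: contrapT.
- by move=> w cG Cw nw0; rewrite later_lt//; exact: contrapT.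
- have mEC : measurable (hit_before c G `&`
      (fun w => shift (hit_time c w) (traj w)) @^-1` C).
    apply: measurableI => //; rewrite -[X in measurable X]setTI.
    by apply: measurable_shift_traj => //; exact: measurable_hit_time.
  move/(negligibleP _ mEC) => PEC.
  have := strong_markov_hit X_csm c XXx0 (nearest_closed nT) (@measurableT _ R) mC.
  rewrite preimage_setT setTI setIT => h.
  have : (0 < P x0 (hit_before c G) * P c (traj @^-1` C))%E by rewrite mule_gt0.
  by rewrite -[ltRHS]h PEC ltxx.
- by rewrite integral_later; exact: integral_gain_nearest_lty.
Qed.

End comparison.

(** The ray from [x0] in direction [e] is a continuous path, and its hitting time of [T] is the
    least distance. *)
Lemma closest_point (T : set R) (x0 e s : R) : closed T -> ~ T x0 ->
  0 <= s -> T (x0 + e * s) ->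
  exists h, [/\ 0 < h, h <= s, T (x0 + e * h) &
    forall r, 0 <= r -> T (x0 + e * r) -> h <= r].
Proof.
move=> cT nT0 s0 Ts; pose w t := x0 + e * t.
have cw : cont0 w.
  apply/cont0_max => t; apply: cvgD; first exact: cvg_cst.
  apply: cvgM; first exact: cvg_cst.
  by apply: continuous_max; [exact: cvg_cst|exact: cvg_id].
have hs : (hit T w <= s%:E)%E by exact: hit_le.
have hE := hit_fin (le_lt_trans hs (ltry s)).
have [h0 Th] := hit_attained cw cT (esym hE).
exists (fine (hit T w)); split => //.
- rewrite lt_neqAle h0 andbT; apply/eqP => hE0; apply: nT0.
  by move: Th; rewrite /w -hE0 mulr0 addr0.
- by rewrite -lee_fin hE.
- by move=> r r0 Tr; rewrite -lee_fin hE; exact: hit_le.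
Qed.

(** The closed half-line to the right of [x0] for [e = 1] and to the left for [e = -1]; the sign
    lets one argument treat both sides. *)
Definition ahead (x0 e : R) : set R := [set y | 0 <= e * (y - x0)].

Lemma closed_ahead x0 e : closed (ahead x0 e).
Proof.
rewrite (_ : ahead x0 e = (fun y => e * (y - x0)) @^-1` [set r | 0 <= r])//.
apply: closed_comp; last exact: closed_ge.
move=> y _; apply: cvgM; first exact: cvg_cst.
by apply: cvgB; [exact: cvg_id|exact: cvg_cst].
Qed.

Lemma nearest_ahead (T : set R) (x0 e z : R) : e = 1 \/ e = -1 ->
  closed T -> ~ T x0 -> XX x0 -> XX z -> T z -> ahead x0 e z ->
  exists c, [/\ nearest T x0 c (T `&` ahead x0 (- e)),
    ahead x0 e c, (x0 <= c <= z) || (z <= c <= x0) &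
    forall y, T y -> ahead x0 e y -> (y <= c <= x0) || (x0 <= c <= y)].
Proof.
move=> e1 cT nT0 XX0 XXz Tz za.
have ee y : x0 + e * (e * (y - x0)) = y by case: e1 => ->; lra.
have [h [h0 hz Th hmin]] : exists h, [/\ 0 < h, h <= e * (z - x0), T (x0 + e * h) &
    forall r, 0 <= r -> T (x0 + e * r) -> h <= r].
  by apply: closest_point => //; rewrite ee.
have cz : (x0 <= x0 + e * h <= z) || (z <= x0 + e * h <= x0).
  case: e1 hz => -> hz; apply/orP; [left|right]; apply/andP; split; lra.
have minc y : T y -> ahead x0 e y -> h <= e * (y - x0).
  by move=> Ty ya; apply: hmin => //; rewrite ee.
have cov y : T y -> ahead x0 e y -> (y <= x0 + e * h <= x0) || (x0 <= x0 + e * h <= y).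
  move=> Ty /(minc _ Ty); case: e1 => -> hy; apply/orP; [right|left];
    apply/andP; split; lra.
exists (x0 + e * h); split => //.
- split => //.
  + by case/orP : cz => ?; [exact: XX_itv XX0 XXz _ _|exact: XX_itv XXz XX0 _ _].
  + by apply/eqP; case: e1 => ->; lra.
  + by apply: closedI => //; exact: closed_ahead.
  (* A point between [x0] and [c] that also lies behind [x0] can only be [x0], which is not in
     [T]. *)
  + move=> y yb [Ty]; rewrite /ahead/= => ya; apply: nT0; suff <- : y = x0 by [].
    by case: e1 ya yb => -> ya /orP[] /andP[? ?]; lra.
  + move=> y XXy Ty; have [ya|ya] := leP 0 (e * (y - x0)); first by right; exact: cov.
    by left; split => //; rewrite /ahead/= mulNr oppr_ge0 ltW.
- by rewrite /ahead/=; case: e1 => ->; lra.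
Qed.

(** * Expected gains of [T] and [F] from a point outside [T] *)

Section gains.
Variables (T F : set R) (x0 c e : R).
Hypotheses (cT : closed T) (cF : closed F) (FT : F `<=` T).
Hypotheses (XXx0 : XX x0) (iXXx0 : XX° x0) (nT0 : ~ T x0).
Hypothesis e1 : e = 1 \/ e = -1.
Hypothesis X_regular : regular XX P X.
Hypothesis optT : forall y, XX y -> T y -> ~ F y ->
  (f y)%:E = (\int[P y]_w (gain F (traj w))%:E)%E.
Local Notation G := (T `&` ahead x0 (- e)).
Hypothesis nT : nearest T x0 c G.
Hypothesis c_ahead : ahead x0 e c.

(** Off the event, [T] can only be entered behind [x0], and the same comparison is run with the
    closest point [b] on that side. *)
Lemma integral_gain_off_nearest :
  (\int[P x0]_(w in ~` hit_before c G) (gain T (traj w))%:E < +oo)%E /\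
  (\int[P x0]_(w in ~` hit_before c G) (gain T (traj w))%:E <=
   \int[P x0]_(w in ~` hit_before c G) (gain F (traj w))%:E)%E.
Proof.
have first w t : X 0 w = x0 -> ~ hit_before c G w -> hit T (traj w) = t%:E ->
    G (X t w).
  move=> w0 ncG tE; have [t0 Tt] := hit_attained (@cfun_cont _ (traj w)) cT tE.
  have [//|btw] := nearest_cover nT (csm_state X_csm w t0) Tt.
  by exfalso; apply: ncG; exact: (nearest_first cT nT w0 tE btw).
have [[y [XXy Gy]]|none] := pselect (exists y, XX y /\ G y); last first.
  have T0 : (\int[P x0]_(w in ~` hit_before c G) (gain T (traj w))%:E = 0)%E.
    rewrite -[RHS](integral0 (P x0) (~` hit_before c G)).
    apply: (ge0_eq_integral_off_null (start_null X_csm XXx0)) => //.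
      by move=> w; rewrite lee_fin gain_ge0.
    move=> w ncG /contrapT w0 /=; congr EFin; rewrite /gain /stopped.
    have := hit_ge0 T (traj w); case tE : (hit T (traj w)) => [t| |]//.
    rewrite lee_fin => t0; exfalso; apply: none; exists (X t w).
    by split; [exact: (csm_state X_csm)|exact: first].
  rewrite T0; split; first exact: ltry.
  by apply: integral_ge0 => w _; rewrite lee_fin gain_ge0.
have Ne1 : - e = 1 \/ - e = -1 by case: e1 => ->; [right|left; rewrite opprK].
have [b [nb b_ahead _ b_cover]] := nearest_ahead Ne1 cT nT0 XXx0 XXy Gy.1 Gy.2.
rewrite opprK in nb; set G' := T `&` ahead x0 e in nb.
have Gb : G b by split => //; exact: nearest_mem nb.
have G'c : G' c by split => //; exact: nearest_mem nT.
have mc := measurable_hit_before X_csm c (nearest_closed nT).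
have mb := measurable_hit_before X_csm b (nearest_closed nb).
(* [b] belongs to [G] and [c] to [G'], so the two points cannot both come first. *)
have sub_bc : hit_before b G' `<=` ~` hit_before c G.
  move=> w bG' cG.
  have cb : (hit G (traj w) <= hit [set b] (traj w))%E.
    apply: le_ereal_inf_tmp => _ [t [t0 Xt] <-]; apply: hit_le => //.
    by rewrite /= in Xt *; rewrite Xt.
  have bc : (hit G' (traj w) <= hit [set c] (traj w))%E.
    apply: le_ereal_inf_tmp => _ [t [t0 Xt] <-]; apply: hit_le => //.
    by rewrite /= in Xt *; rewrite Xt.
  have := lt_le_trans cG cb; have := lt_le_trans bG' bc.
  by move=> h1 h2; have := lt_trans h1 h2; rewrite ltxx.
(* A path from [x0] that enters [T] off the event does so behind [x0], hence at [b]; the others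
   contribute [0]. *)
have -> : (\int[P x0]_(w in ~` hit_before c G) (gain T (traj w))%:E =
    \int[P x0]_(w in hit_before b G') (gain T (traj w))%:E)%E.
  rewrite integral_mkcond [RHS]integral_mkcond.
  apply: (ge0_eq_integral_off_null (start_null X_csm XXx0)) => //.
  - by move=> w; apply: erestrict_ge0 => v _; rewrite lee_fin gain_ge0.
  - by move=> w; apply: erestrict_ge0 => v _; rewrite lee_fin gain_ge0.
  move=> w _ /contrapT w0; rewrite !patchE.
  have [bG'|nbG'] := pselect (hit_before b G' w).
    by rewrite !mem_set//; exact: sub_bc.
  rewrite [in RHS]memNset//; case: ifPn => // /[!inE] ncG.
  congr EFin; rewrite /gain /stopped.
  have := hit_ge0 T (traj w); case tE : (hit T (traj w)) => [t| |]//.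
  have [Tt ta] := first _ _ w0 ncG tE.
  exfalso; apply: nbG'; apply: (nearest_first cT nb w0 tE).
  exact: b_cover.
split; first exact: integral_gain_nearest_lty.
apply: (@le_trans _ _ (\int[P x0]_(w in hit_before b G') (gain F (traj w))%:E)%E).
  have [Fb|nFb] := pselect (F b); first exact: integral_gain_nearest_mem.
  apply: integral_gain_nearest_le => //.
  by apply: optT => //; [exact: nearest_state nb|exact: nearest_mem nb].
apply: ge0_subset_integral => //; first exact: measurableC.
  apply/measurable_EFinP; apply: measurable_funS (measurable_gain_traj cF) => //.
by move=> w _; rewrite lee_fin gain_ge0.
Qed.

Lemma integral_gain_lt : ~ F c -> 0 < f c ->
  (\int[P x0]_w (gain T (traj w))%:E < \int[P x0]_w (gain F (traj w))%:E)%E.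
Proof.
move=> nFc fc0; have mE := measurable_hit_before X_csm c (nearest_closed nT).
have split_ (H : set R) : closed H -> (\int[P x0]_w (gain H (traj w))%:E =
    \int[P x0]_(w in hit_before c G) (gain H (traj w))%:E +
    \int[P x0]_(w in ~` hit_before c G) (gain H (traj w))%:E)%E.
  move=> cH; rewrite -ge0_integral_setU ?setUv//.
  - exact: measurableC.
  - by apply/measurable_EFinP; exact: measurable_gain_traj.
  - by move=> w _; rewrite lee_fin gain_ge0.
  - by rewrite disj_set2E setICr.
rewrite !split_//; have [offoo offle] := integral_gain_off_nearest.
(* Finiteness of the part off the event keeps the strict inequality. *)
apply: lte_leD => //.
  rewrite ge0_fin_numE//; apply: integral_ge0 => w _; rewrite lee_fin gain_ge0//.
apply: integral_gain_nearest_lt => //.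
  by apply: optT => //; [exact: nearest_state nT|exact: nearest_mem nT].
apply: hit_before_gt0 => //.
- exact: nearest_state nT.
- exact: nearest_closed nT.
- by rewrite eq_sym; exact: nearest_neq nT.
- exact: nearest_avoid nT.
Qed.

End gains.

Lemma J_ge0 z A : (0 <= J P X f delta z A)%E.
Proof. by apply: integral_ge0 => w _; exact: payoff_ge0. Qed.

Lemma gain_null F c : closed F -> (\int[P c]_w (gain F (traj w))%:E = 0)%E ->
  P c (traj @^-1` [set w : cpath R | 0 < gain F w]) = 0%E.
Proof.
move=> cF c0; apply/negligibleP.
  rewrite -[X in measurable X]setTI; apply: (measurable_traj X_csm) => //.
  exact: measurable_gain_gt0.
rewrite -[X in _.-negligible X]setTI.
apply: (@ge0_integral_eq0_negligible _ _ _ (P c) setT (fun w => gain F (traj w))) => //.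
- exact: measurable_gain_traj.
- by move=> w; exact: gain_ge0.
Qed.

(** From [c] the point [z] is reached before [F] with positive probability; a positive gain from [z]
    would then give a positive gain from [c]. *)
Lemma gain_zero_spread F c z : regular XX P X -> closed F -> XX° c -> XX z ->
  (forall y, (c <= y <= z) || (z <= y <= c) -> ~ F y) ->
  (\int[P c]_w (gain F (traj w))%:E = 0)%E ->
  (\int[P z]_w (gain F (traj w))%:E = 0)%E.
Proof.
move=> X_regular cF ic XXz nF c0.
have [<-//|cz] := eqVneq c z; have XXc := interior_subset ic.
pose C := [set w : cpath R | 0 < gain F w].
have mC : measurable C by exact: measurable_gain_gt0.
have PzF := hit_before_gt0 X_csm X_regular ic XXz cF cz nF.
have mE := measurable_hit_before X_csm z cF.
have mEC : measurable (hit_before z F `&`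
    (fun w => shift (hit_time z w) (traj w)) @^-1` C).
  apply: measurableI => //; rewrite -[X in measurable X]setTI.
  by apply: measurable_shift_traj => //; exact: measurable_hit_time.
have EC0 : P c (hit_before z F `&`
    (fun w => shift (hit_time z w) (traj w)) @^-1` C) = 0%E.
  apply/negligibleP => //; apply: negligibleS ((negligibleP _ _).2 (gain_null cF c0)).
    move=> w [zF gC] /=; apply: (lt_le_trans _ (@gain_shift_le F (traj w) _ (hit_time_ge0 X_csm z w) _)).
      by rewrite mulr_gt0// discount_gt0// hit_time_ge0.
    by rewrite -(hit_before_fin zF) ltW.
  by rewrite -[X in measurable X]setTI; exact: (measurable_traj X_csm).
have := strong_markov_hit X_csm z XXc cF (@measurableT _ R) mC.
rewrite preimage_setT setTI setIT => h.
have : (P c (hit_before z F) * P z (traj @^-1` C) = 0)%E by apply: etrans EC0; exact: esym h.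
move/eqP; rewrite mule_eq0 (gt_eqF PzF)/= => /eqP.
exact: integral_gain_eq0.
Qed.

(** * Optimal equilibria and the gaps between their points *)

Section equilibria.
Local Notation J := (J P X f delta).
Local Notation equilibrium := (equilibrium XX P X f delta).
Local Notation optimal := (optimal_equilibrium XX P X f delta).

Lemma equilibrium_notin A z : equilibrium A -> XX z -> ~ A z -> ((f z)%:E <= J z A)%E.
Proof.
move=> [_ _ TA] XXz nAz; rewrite leNgt; apply/negP => Jf; apply: nAz.
by rewrite -TA; left.
Qed.

Lemma equilibrium_in A z : equilibrium A -> A z -> (J z A <= (f z)%:E)%E.
Proof.
move=> [_ _ TA]; rewrite -{1}TA => -[[_ /ltW//]|[[_ <-]//]].
Qed.

Lemma optimal_V A B z : optimal A -> optimal B -> XX z ->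
  V P X f delta z A = V P X f delta z B.
Proof.
by move=> [eA oA] [eB oB] XXz; apply/eqP; rewrite eq_le oA// oB.
Qed.

Lemma eq_J_optimal A B : optimal A -> equilibrium B ->
  (forall z, XX z -> J z B = J z A) -> optimal B.
Proof.
move=> [_ oA] eB BA; split => // z D XXz eD.
by rewrite [leRHS]/V BA//; exact: oA.
Qed.

Lemma optimal_gap_eq0 (T S I : set R) x0 t : regular XX P X ->
  optimal T -> optimal S -> closed_in XX T -> closed_in XX S -> S `<=` T ->
  I `<=` XX° -> I `&` S = set0 ->
  (forall y z u, I y -> I z -> y <= u -> u <= z -> I u) ->
  I x0 -> ~ T x0 -> I t -> T t ->
  forall z, I z -> J z S = 0%E /\ f z = 0.
Proof.
move=> X_regular oT oS cT cS ST IXX IS Iconv Ix0 nT0 It Tt z Iz.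
have XXI y : I y -> XX y by move=> /IXX; exact: interior_subset.
have nSI y : I y -> ~ S y.
  by move=> Iy Sy; have : (I `&` S) y by []; rewrite IS.
have clE A y : closed_in XX A -> XX y -> closure A y -> A y.
  by move=> cA XXy clA; rewrite (closed_inE cA).
(* On [T] the value is [f], so equality of the two values gives [J(., S) <= f]; the reverse holds
   outside the equilibrium [S]. *)
have optT y : XX y -> closure T y -> ~ closure S y ->
    (f y)%:E = (\int[P y]_w (gain (closure S) (traj w))%:E)%E.
  move=> XXy /(clE _ _ cT XXy) Ty nclSy.
  have nSy : ~ S y by move=> /subset_closure.
  rewrite -J_gain//; apply/eqP; rewrite eq_le equilibrium_notin//; last exact: oS.1.
  have := optimal_V oT oS XXy; rewrite /V max_l; last exact: equilibrium_in oT.1 _.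
  by move=> ->; rewrite le_max lexx orbT.
have nclT0 : ~ closure T x0 by move=> /(clE _ _ cT (XXI _ Ix0)).
have nclSI y : I y -> ~ closure S y.
  by move=> Iy /(clE _ _ cS (XXI _ Iy)); exact: nSI.
have clT : closed (closure T) by exact: closed_closure.
have clS : closed (closure S) by exact: closed_closure.
have clST : closure S `<=` closure T by exact: closure_subset.
have [e e1 ta] : exists2 e : R, e = 1 \/ e = -1 & ahead x0 e t.
  have [xt|tx] := leP x0 t.
    by exists 1; [left|rewrite /ahead/=; lra].
  by exists (-1); [right|rewrite /ahead/=; lra].
have [c [nc ca cb _]] :=
  nearest_ahead e1 clT nclT0 (XXI _ Ix0) (XXI _ It) (subset_closure Tt) ta.
have Ic : I c by case/orP : cb => /andP[? ?]; [exact: Iconv Ix0 It _ _|exact: Iconv It Ix0 _ _].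
(* Otherwise [S] gains strictly more than [T] from [x0], although both integrals equal the value
   there. *)
have fc0 : f c = 0.
  apply/eqP; rewrite eq_le (f_ge0 (XXI _ Ic)) andbT leNgt; apply/negP => fcgt0.
  have := integral_gain_lt clT clS clST (XXI _ Ix0) (IXX _ Ix0) nclT0 e1
    X_regular optT nc ca (nclSI _ Ic) fcgt0.
  rewrite -!J_gain//; [|exact: XXI|exact: nSI|exact: XXI].
  have := optimal_V oT oS (XXI _ Ix0); rewrite /V !max_r.
  - by move=> ->; rewrite ltxx.
  - by apply: equilibrium_notin => //; [exact: oS.1|exact: XXI|exact: nSI].
  - by apply: equilibrium_notin => //; [exact: oT.1|exact: XXI].
have gc0 : (\int[P c]_w (gain (closure S) (traj w))%:E = 0)%E.
  rewrite -optT ?fc0//; [exact: XXI|exact: nearest_mem nc|exact: nclSI].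
have Jz0 : J z S = 0%E.
  rewrite J_gain//; [|exact: XXI|exact: nSI].
  apply: gain_zero_spread X_regular clS (IXX _ Ic) (XXI _ Iz) _ gc0.
  move=> y /orP[] /andP[? ?]; apply: nclSI; [exact: Iconv Ic Iz _ _|exact: Iconv Iz Ic _ _].
split => //; apply/eqP; rewrite eq_le (f_ge0 (XXI _ Iz)) andbT.
by have := equilibrium_notin oS.1 (XXI _ Iz) (nSI _ Iz); rewrite Jz0 lee_fin.
Qed.

Lemma rho_shift (S : set R) w s : closed_in XX S -> 0 < s ->
  (s%:E < rho X S w)%E ->
  rho X S w = (s%:E + hit (closure S) (shift s (traj w)))%E.
Proof.
move=> cS s0 sr; have SE := closed_inE cS.
rewrite shiftE ?ltW//; apply/eqP; rewrite eq_le; apply/andP; split.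
  rewrite addeC -leeBlDr//; apply: le_ereal_inf_tmp => _ [t [t0 St] <-].
  rewrite leeBlDr// -EFinD; apply: ereal_inf_lbound; exists (t + s) => //.
  split; first by rewrite ltr_wpDl.
  rewrite SE addrC; split => //.
  by apply: (csm_state X_csm); rewrite addr_ge0// ltW.
apply: le_ereal_inf_tmp => _ [t [t0 St] <-].
have st : s <= t.
  rewrite -lee_fin ltW// (lt_le_trans sr)//.
  by apply: ereal_inf_lbound; exists t.
rewrite addeC -leeBrDr// -EFinB hit_le ?subr_ge0//.
by rewrite addrC subrK; exact: subset_closure.
Qed.

(* Both payoffs vanish when the path visits [A] strictly before [S]. *)
Lemma payoff_setU (S I A : set R) w : closed_in XX S -> open I -> I `<=` XX ->
  A `<=` I -> (forall y, I y -> f y = 0) ->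
  delta t * f (X t w) @[t --> +oo] --> 0 ->
  (forall q : rat, 0 <= (ratr q : R) -> I (X (ratr q) w) ->
    gain (closure S) (shift (ratr q) (traj w)) <= 0) ->
  payoff X f delta (S `|` A) w = payoff X f delta S w.
Proof.
move=> cS oI IXX AI f0 lim0 gain0.
have : (rho X (S `|` A) w <= rho X S w)%E.
  apply: ereal_inf_le_tmp => _ [t [t0 St] <-]; exists t => //.
  by split => //; left.
rewrite le_eqVlt => /orP[/eqP rE|]; first by rewrite /payoff rE.
have : (0 <= rho X (S `|` A) w)%E.
  by apply: le_ereal_inf_tmp => _ [t [t0 _] <-]; rewrite lee_fin ltW.
case tE : (rho X (S `|` A) w) => [t| |]; [|by move=> _; rewrite ltNge leey|by []].
rewrite lee_fin => t0 tS.
(* The infimum [t] need not be attained, but there are visits to [A] as close to it as desired, all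
   before [S]. *)
have visit (m : \bar R) : (t%:E < m)%E -> exists s, [/\ t <= s, 0 < s, (s%:E < m)%E,
    (s%:E < rho X S w)%E & A (X s w)].
  move=> tm; have : (rho X (S `|` A) w < mine m (rho X S w))%E by rewrite tE lt_min tm.
  move=> /ereal_inf_lt[_ [s [s0 SAs] <-]]; rewrite lt_min => /andP[sm sS].
  exists s; split => //.
    by rewrite -lee_fin -tE; apply: ereal_inf_lbound; exists s.
  case: SAs => // Ss; exfalso; move: sS; rewrite ltNge => /negP; apply.
  by apply: ereal_inf_lbound; exists s.
(* [X t w] may lie outside [I]; by continuity a positive reward there would persist at nearby visits
   to [A], where [f] is [0]. *)
have fXt : f (X t w) = 0.
  apply/eqP; rewrite eq_le f_ge0 ?andbT; last exact: (csm_state X_csm).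
  rewrite leNgt; apply/negP => ft.
  have XXt : XX (X t w) by exact: (csm_state X_csm).
  have /subspace_continuousP/(_ _ XXt)/cvgr_gt := f_cont.
  move=> /(_ _ ft); rewrite near_withinE => /nbhs_ballP[e /= e0 He].
  have := (cont0_max _).1 (@cfun_cont _ (traj w)) t.
  rewrite /continuous_at /= max_r// => /cvgrPdist_lt/(_ _ e0).
  move=> /nbhs_ballP[h /= h0 Hh].
  have [|s [ts s0 sm _ As]] := visit (t + h)%:E; first by rewrite lte_fin ltrDl.
  have Xs : ball (X t w) e (X s w).
    have := Hh s; rewrite max_r ?ltW//; apply.
    by rewrite /ball/= ler0_norm ?subr_le0//; rewrite lte_fin in sm; lra.
  have fs : 0 < f (X s w) := He _ Xs (IXX _ (AI _ As)).
  by move: fs; rewrite (f0 _ (AI _ As)) ltxx.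
have [s [_ s0 _ sS As]] := visit _ tS.
have : \forall r \near s, I (X (Num.max 0 r) w).
  have := (cont0_max _).1 (@cfun_cont _ (traj w)) s.
  rewrite /continuous_at /= max_r ?ltW// => cs; apply: cs.
  by apply: open_nbhs_nbhs; split => //; exact: AI.
move=> /nbhs_ballP[h /= h0 Hh].
(* As [I] is open, the visit can be moved to a rational time still before [S], where [gain0]
   applies. *)
have [q [sq qS Iq]] : exists q : rat, [/\ s < ratr q :> R,
    ((ratr q)%:E < rho X S w)%E & I (X (ratr q) w)].
  have sm : (s%:E < mine (s + h)%:E (rho X S w))%E by rewrite lt_min lte_fin ltrDl h0.
  have mlt : (mine (s + h)%:E (rho X S w) < +oo)%E by rewrite gt_min ltry.
  case mE : (mine (s + h)%:E (rho X S w)) sm mlt => [m| |]//.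
  rewrite lte_fin => sm _; have [q] := rat_in_itvoo sm.
  rewrite in_itv/= => /andP[sq qm].
  have : ((ratr q)%:E < mine (s + h)%:E (rho X S w))%E by rewrite mE lte_fin.
  rewrite lt_min lte_fin => /andP[qh qS]; exists q; split => //.
  have := Hh (ratr q); rewrite max_r; last by rewrite ltW// (lt_trans s0).
  by apply; rewrite /ball/= ltr0_norm; lra.
have q0 : 0 < ratr q :> R by exact: lt_trans sq.
have := gain0 q (ltW q0) Iq.
rewrite /payoff tE fXt mulr0 (rho_shift cS q0 qS) /gain /stopped.
have := hit_ge0 (closure S) (shift (ratr q) (traj w)).
case: (hit _ _) => //= [r|_ _].
  rewrite lee_fin (max_r (ltW q0)) => r0; rewrite pmulr_rle0 ?discount_gt0// => fr.
  have XXr : XX (X (ratr q + r) w) by apply: (csm_state X_csm); rewrite addr_ge0// ltW.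
  have fr0 : f (X (ratr q + r) w) = 0.
    by apply/eqP; rewrite eq_le f_ge0// andbT -state_payoffE.
  by rewrite fr0 mulr0.
apply/esym/eqP; rewrite eq_le limf_esup_cvg0//=.
(* The limit superior is the payoff of the empty set, hence nonnegative. *)
have := payoff_ge0 set0 w; rewrite /payoff.
rewrite (_ : rho X set0 w = +oo%E)//.
by rewrite /rho (_ : [set _ | _] = set0) ?image_set0 ?ereal_inf0//; apply/seteqP; split => // u [].
Qed.

(** From a point of [I] the gain at [S] is almost surely [0]. The Markov property carries this to
    every rational time spent in [I], at the cost of countably many null sets. *)
Lemma J_setU (S I A : set R) x : closed_in XX S -> open I -> I `<=` XX ->
  A `<=` I -> (forall y, I y -> ~ S y) ->
  (forall y, I y -> f y = 0) -> (forall y, I y -> J y S = 0%E) ->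
  XX x -> J x (S `|` A) = J x S.
Proof.
move=> cS oI IXX AI IS f0 J0 XXx.
have clS : closed (closure S) by exact: closed_closure.
pose C := [set w : cpath R | 0 < gain (closure S) w].
have mC : measurable C by exact: measurable_gain_gt0.
have mI : measurable I by exact: open_measurable.
have Nq q : (P x).-negligible (if 0 <= (ratr q : R) then X (ratr q) @^-1` I `&`
    (fun w => shift (ratr q) (traj w)) @^-1` C else set0).
  case: ifPn => [q0|_]; last exact: negligible_set0.
  apply/negligibleP.
    apply: measurableI; rewrite -[X in measurable X]setTI.
      exact: (measurable_X X_csm q0).
    by apply: measurable_shift_traj.
  apply: markov_null => // y XXy Iy; apply: gain_null => //.
  by rewrite -J_gain//; [exact: J0|exact: IS].
apply: (ge0_eq_integral_off_null
  (negligibleU (payoff_cvg0 XXx) (negligible_bigcup_rat Nq))).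
- by move=> w; exact: payoff_ge0.
- by move=> w; exact: payoff_ge0.
move=> w _ nNw; apply: (payoff_setU cS oI) => //.
  by apply: contrapT => nlim; apply: nNw; left.
move=> q q0 Iq; rewrite leNgt; apply/negP => gq; apply: nNw; right.
by exists q => //; rewrite q0.
Qed.

(** Since [J] is unchanged, so are the strict and the indifferent points; those of [A] are
    indifferent because both sides are [0]. *)
Lemma optimal_setU (S I A : set R) : optimal S -> closed_in XX S -> open I ->
  I `<=` XX -> (forall y, I y -> ~ S y) ->
  (forall y, I y -> f y = 0) -> (forall y, I y -> J y S = 0%E) ->
  measurable A -> A `<=` I -> optimal (S `|` A).
Proof.
move=> oS cS oI IXX IS f0 J0 mA AI.
have JE x : XX x -> J x (S `|` A) = J x S by exact: J_setU cS oI IXX AI IS f0 J0.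
apply: (eq_J_optimal oS _ JE); have [[mS SXX TS] _] := oS; split.
- exact: measurableU.
- by rewrite subUset; split => // y /AI /IXX.
apply/seteqP; split => [y [[XXy]|[]//]|y].
  by rewrite JE// => Sy; left; rewrite -TS; left.
case=> [Sy|Ay].
  have XXy := SXX _ Sy; move: (Sy); rewrite -{1}TS => -[[_ Jf]|[[_ fJ] _]].
    by left; split => //; rewrite JE.
  by right; split; [split => //; rewrite JE|left].
have Iy := AI _ Ay; right; split; last by right.
by split; [exact: IXX|rewrite JE ?J0 ?f0//; exact: IXX].
Qed.

End equilibria.

End payoffs.

(** * Order and topology of gaps *)

Section gaps.
Context {R : realType} (XX A : set R) (x : R).
Hypothesis XX_itv : is_interval XX.
Hypothesis AXX : A `<=` XX.
Hypothesis nAx : ~ A x.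

(** Whichever case defines the endpoint, some state lies to the left of [z]; with its mirror image
    this makes the points of a gap interior to [XX]. *)
Lemma gap_left_lt z : (gap_left XX A x < z%:E)%E ->
  (exists2 y, XX y & y < z) /\ (forall y, A y -> y < x -> y < z).
Proof.
rewrite /gap_left; case: pselect => [[y Ay yx]|none] /= gz.
  have ltz u : A u -> u < x -> u < z.
    move=> Au ux; rewrite -lte_fin; apply: le_lt_trans gz.
    by apply: ereal_sup_ubound; exists u.
  by split => //; exists y; [exact: AXX|exact: ltz].
split.
  by have [_ [y XXy <-]] := ereal_inf_lt gz; rewrite lte_fin; exists y.
by move=> y Ay yx; exfalso; apply: none; exists y.
Qed.

Lemma lt_gap_right z : (z%:E < gap_right XX A x)%E ->
  (exists2 y, XX y & z < y) /\ (forall y, A y -> x < y -> z < y).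
Proof.
rewrite /gap_right; case: pselect => [[y Ay yx]|none] /= gz.
  have ltz u : A u -> x < u -> z < u.
    move=> Au ux; rewrite -lte_fin; apply: lt_le_trans gz _.
    by apply: ereal_inf_lbound; exists u.
  by split => //; exists y; [exact: AXX|exact: ltz].
split.
  by have [_ [y XXy <-]] := ereal_sup_gt gz; rewrite lte_fin; exists y.
by move=> y Ay yx; exfalso; apply: none; exists y.
Qed.

Lemma gap_interior : gap XX A x `<=` XX°.
Proof.
move=> z [/gap_left_lt[[a XXa az] _] /lt_gap_right[[b XXb zb] _]].
apply: (@filterS _ _ _ `]a, b[%classic).
  move=> u /=; rewrite in_itv/= => /andP[au ub].
  by apply: XX_itv XXa XXb _ _; rewrite !ltW.
by apply: open_nbhs_nbhs; split => //=; rewrite in_itv/= az zb.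
Qed.

Lemma gap_notin z : gap XX A x z -> ~ A z.
Proof.
move=> [/gap_left_lt[_ zl] /lt_gap_right[_ zr]] Az.
have [zx|xz|zx] := ltgtP z x.
- by have := zl _ Az zx; rewrite ltxx.
- by have := zr _ Az xz; rewrite ltxx.
- by apply: nAx; rewrite -zx.
Qed.

Lemma gap_convex y z u : gap XX A x y -> gap XX A x z -> y <= u -> u <= z ->
  gap XX A x u.
Proof.
move=> [yl _] [_ zr] yu uz; split.
  by apply: lt_le_trans yl _; rewrite lee_fin.
by apply: le_lt_trans zr; rewrite lee_fin.
Qed.

Lemma open_gap : open (gap XX A x).
Proof.
rewrite (_ : gap XX A x = [set z | (gap_left XX A x < z%:E)%E] `&`
  [set z | (z%:E < gap_right XX A x)%E])//.
apply: openI.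
  case: (gap_left XX A x) => [l| |].
  - rewrite (_ : [set _ | _] = [set z | l < z]); first exact: open_gt.
    by apply/seteqP; split => z /=; rewrite lte_fin.
  - rewrite (_ : [set _ | _] = set0); first exact: open0.
    by apply/seteqP; split => z //=; rewrite ltNge leey.
  - rewrite (_ : [set _ | _] = setT); first exact: openT.
    by apply/seteqP; split => z //= _; exact: ltNyr.
case: (gap_right XX A x) => [l| |].
- rewrite (_ : [set _ | _] = [set z | z < l]); first exact: open_lt.
  by apply/seteqP; split => z /=; rewrite lte_fin.
- rewrite (_ : [set _ | _] = setT); first exact: openT.
  by apply/seteqP; split => z //= _; exact: ltry.
- rewrite (_ : [set _ | _] = set0); first exact: open0.
  by apply/seteqP; split => z //=; rewrite ltNge leNye.
Qed.

End gaps.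

Theorem corollary5p2 (d : measure_display) (R : realType)
  (Omega : measurableType d) (XX : set R) (P : R -> probability Omega R)
  (X : R -> Omega -> R) (f delta : R -> R) (Tstar : set R)
  (XX_itv : is_interval XX)
  (X_csm : continuous_strong_markov_process XX P X)
  (f_ge0 : forall x, XX x -> 0 <= f x)
  (f_cont : {within XX, continuous f})
  (delta_disc : discount_function delta)
  (payoff_cvg0 : forall x, XX x ->
     {ae P x, forall w, delta t * f (X t w) @[t --> +oo] --> 0})
  (X_regular : regular XX P X)
  (delta_dec : forall s t, 0 < s -> 0 < t -> delta s * delta t < delta (s + t))
  (Tstar_closed : closed_in XX Tstar)
  (Tstar_opt : optimal_equilibrium XX P X f delta Tstar)
  (Rstar_opt : optimal_equilibrium XX P X f delta (Rstar XX P X f delta))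
  (x : R) (XXx : XX x) (Rstarx : ~ Rstar XX P X f delta x) :
  let Rs := Rstar XX P X f delta in
  let I := gap XX Rs x in
  [/\ I `&` C_ XX P X f delta Rs !=set0 -> Tstar `&` I = set0,
      I `&` C_ XX P X f delta Rs = set0 ->
        ~ (forall y, I y -> f y = 0) ->
        Tstar `&` I = set0 \/ I `<=` Tstar
    & I `&` C_ XX P X f delta Rs = set0 ->
        (forall y, I y -> f y = 0) ->
        forall A : set R, measurable A -> A `<=` I ->
          optimal_equilibrium XX P X f delta (Rs `|` A)].
Proof.
move=> Rs I.
have RsT : Rs `<=` Tstar by apply: bigcap_inf; split => //; exact: Tstar_opt.1.
have TXX : Tstar `<=` XX by have [[]] := Tstar_opt.
have RsXX : Rs `<=` XX by move=> y /RsT /TXX.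
have cRs : closed_in XX Rs.
  exists (closure Rs); first exact: closed_closure.
  apply/seteqP; split => [y Rsy|y [XXy clRs] A [eA cA]].
    by split; [exact: RsXX|exact: subset_closure].
  rewrite (closed_inE cA); split => //; apply: closure_subset clRs.
  exact: bigcap_inf.
have IXX : I `<=` XX° by exact: gap_interior.
have IRs y : I y -> ~ Rs y by exact: gap_notin.
have IXX' y : I y -> XX y by move=> /IXX; exact: interior_subset.
have key y t z : I y -> ~ Tstar y -> I t -> Tstar t -> I z ->
    J P X f delta z Rs = 0%E /\ f z = 0.
  move=> Iy nTy It Tt; move: z.
  apply: (optimal_gap_eq0 XX_itv X_csm f_ge0 f_cont delta_disc payoff_cvg0 delta_dec
    X_regular Tstar_opt Rstar_opt Tstar_closed cRs RsT IXX _ _ Iy nTy It Tt) => //.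
  - by apply/seteqP; split => // u [/IRs].
  - by move=> u v s; exact: gap_convex.
split.
- move=> [y [Iy [XXy fJ]]]; apply/seteqP; split => // t [Tt It].
  (* On [Tstar] the common value is [f], which would bound [J(., Rs)] and exclude [y] from [C_]. *)
  have nTy : ~ Tstar y.
    move=> /(equilibrium_in Tstar_opt.1) JT.
    have := optimal_V Tstar_opt Rstar_opt XXy.
    rewrite /V max_l// => fV; move: fJ; rewrite ltNge => /negP; apply.
    by rewrite fV le_max lexx orbT.
  have [J0 f0] := key _ _ _ Iy nTy It Tt Iy.
  by move: fJ; rewrite -/Rs J0 f0 ltxx.
- move=> _ nf; have [TI|/eqP/set0P[t [Tt It]]] := pselect (Tstar `&` I = set0); first by left.
  right => y Iy; apply: contrapT => nTy; apply: nf => z Iz.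
  by have [] := key _ _ _ Iy nTy It Tt Iz.
move=> IC f0 A mA AI.
have oI : open I by exact: open_gap.
apply: (optimal_setU XX_itv X_csm f_ge0 f_cont delta_disc payoff_cvg0
  Rstar_opt cRs oI IXX' IRs f0 _ mA AI).
(* As the gap misses [C_], [J] is at most [f = 0] there. *)
move=> y Iy; apply/eqP; rewrite eq_le (J_ge0 X_csm f_ge0 delta_disc)// andbT leNgt; apply/negP => Jy.
suff : (I `&` C_ XX P X f delta Rs) y by rewrite IC.
by split => //; split; [exact: IXX'|rewrite f0].
Qed.
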